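(* Let $L$ be a regular Lagrangian on $TQ$ and let $J$ be a type $(1,1)$ tensor field on $Q$. Let $R$ be the type $(1,1)$ tensor field on $TQ$ defined by $i_{R(\xi)}\,d d_S L = i_\xi\, d d_{J^cS}L$ for all vector fields $\xi$ on $TQ$. Then for every vector field $X$ along $\tau:TQ\to Q$, $$R(X^{V}) = (\overline{J}X)^{V},\qquad R(X^{H}) = (JX)^{H} + (UX)^{V},$$ where $\overline{J}$ is the transpose of $J$ with respect to $g=D^{V}D^{V}L$, i.e. $g(JX,Y)=g(X,\overline{J}Y)$, and $U$ is the type $(1,1)$ tensor field along $\tau$ determined by $$g(UX,Y) = d^{H}(J\theta_L)(X,Y)\qquad \text{for all vector fields } X,Y \text{ along } \tau.$$
   Context: $Q$ is a smooth $n$-dimensional manifold, $\tau:TQ\to Q$ its tangent bundle with natural coordinates $(q^i,u^i)$. $L\in C^\infty(TQ)$ is regular: the Hessian $g_{ij}=\partial^2L/\partial u^i\partial u^j$ is everywhere non-singular. $S=\frac{\partial}{\partial u^i}\otimes dq^i$ is the vertical endomorphism. A type $(1,1)$ tensor field $K$ acts on 1-forms by $(K\alpha)(\xi)=\alpha(K\xi)$, and $d_KL:=K(dL)=dL\circ K$. Put $\theta_L=d_SL$, $\omega_L=d\theta_L$ (symplectic). With $\Delta=u^i\partial/\partial u^i$ and $E_L=\Delta(L)-L$, the Euler-Lagrange field $\Gamma=u^i\frac{\partial}{\partial q^i}+f^i\frac{\partial}{\partial u^i}$ is defined by $i_\Gamma d\theta_L=-dE_L$. The complete lift $J^c$ of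 $J$ is the type $(1,1)$ tensor field on $TQ$ with $J^c(X^c)=(JX)^c$, $J^c(X^V)=(JX)^V$ for vector fields $X$ on $Q$, where $X^c$, $X^V$ are the complete and vertical lifts; $J^cS$ is the composition of endomorphisms. Connection: $\Gamma^i_j=-\frac12\partial f^i/\partial u^j$, $H_i=\frac{\partial}{\partial q^i}-\Gamma^k_i\frac{\partial}{\partial u^k}$, $V_i=\frac{\partial}{\partial u^i}$. For a vector field $X=X^i(q,u)\partial/\partial q^i$ along $\tau$ put $X^H=X^iH_i$, $X^V=X^iV_i$. The horizontal and vertical covariant derivatives act on functions $F\in C^\infty(TQ)$ by $D^H_XF=X^H(F)$, $D^V_XF=X^V(F)$, on vector fields along $\tau$ they are determined by $[X^H,Y^V]=(D^H_XY)^V-(D^V_YX)^H$, and they extend to tensor fields along $\tau$ as derivations commuting with contractions. $g=D^VD^VL$ is the symmetric $(0,2)$ tensor field along $\tau$ with components $g_{ij}$. The semi-basic form $\theta_L$ is identified with the 1-form along $\tau$ given by $\theta_L(X)=D^V_XL$; $J$ is regarded as a tensor field along $\tau$, and $(J\theta_L)(X)=\theta_L(JX)$. For a 1-form $\alpha$ along $\tau$, $d^H\alpha(X,Y)=(D^H_X\alpha)(Y)-(D^H_Y\alpha)(X)$. *)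

(* Defs.v *)
From HB Require Import structures.
From mathcomp Require Import all_boot all_order all_algebra.
From mathcomp Require Import all_classical all_reals all_analysis.
Set Implicit Arguments.
Unset Strict Implicit.
Unset Printing Implicit Defensive.
Import Order.TTheory GRing.Theory Num.Theory.
Import numFieldNormedType.Exports.
Local Open Scope classical_set_scope.
Local Open Scope ring_scope.

Section Smooth.
Context {R : realType} {V W : normedModType R}.

Definition iter_derive (vs : seq V) (f : V -> W) : V -> W :=
  foldr (fun v g => 'D_v g) f vs.

(* C^oo on the open set [U], for finite dimensional [V]. *)
Definition smooth_on (U : set V) (f : V -> W) : Prop :=
  forall (vs : seq V) (x : V), U x -> differentiable (iter_derive vs f) x.

Lemma smooth_on_diff (U : set V) (f : V -> W) x :
  smooth_on U f -> U x -> differentiable f x.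
Proof. by move=> sf Ux; exact: (sf [::] x Ux). Qed.

Lemma iter_derive_ext (U : set V) (f g : V -> W) (vs : seq V) : open U ->
  (forall x, U x -> f x = g x) ->
  forall x, U x -> iter_derive vs f x = iter_derive vs g x.
Proof.
move=> oU fg; elim: vs => [|v vs IH] //= x Ux.
by apply: near_eq_derive; apply: filterS (open_nbhs_nbhs (conj oU Ux)) => y /IH.
Qed.

Lemma near_eq_differentiable (f g : V -> W) (x : V) :
  (\forall y \near x, f y = g y) -> differentiable f x ->
  differentiable g x /\ ('d g x = 'd f x :> (V -> W)).
Proof.
move=> fg df.
have key : g \o shift x = cst (g x) + 'd f x +o_ 0 id.
  rewrite -(nbhs_singleton fg).
  apply/eqaddoP => e e0.
  have /eqaddoP/(_ e e0) := diff_locally df.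
  have : \forall h \near 0, f (h + x) = g (h + x).
    by move: fg; rewrite (near_shift 0 x) subr0.
  apply: filterS2 => h /= fgh.
  by rewrite !fctE /= fgh.
have dgE : 'd g x = 'd f x :> (V -> W).
  by apply: diff_unique => //; exact: diff_continuous.
split=> //; apply/diff_locallyP; rewrite dgE; split=> //.
exact: diff_continuous.
Qed.

Lemma smooth_on_ext (U : set V) (f g : V -> W) : open U ->
  (forall x, U x -> f x = g x) -> smooth_on U f -> smooth_on U g.
Proof.
move=> oU fg sf vs x Ux.
have [] // := @near_eq_differentiable (iter_derive vs f) (iter_derive vs g) x.
  apply: filterS (open_nbhs_nbhs (conj oU Ux)) => y Uy.
  exact: (iter_derive_ext _ oU).
exact: sf.
Qed.

End Smooth.

Section SmoothCalculus.
Context {R : realType} {V W : normedModType R}.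
Implicit Types (U : set V) (f g : V -> W).

Lemma smooth_on_derive U f v : smooth_on U f -> smooth_on U ('D_v f).
Proof.
by move=> sf vs x Ux; have := sf (rcons vs v) x Ux;
   rewrite /iter_derive -cats1 foldr_cat.
Qed.

Lemma smooth_on_iter_derive U f vs : smooth_on U f -> smooth_on U (iter_derive vs f).
Proof. by move=> sf; elim: vs => // v vs IH; exact: smooth_on_derive. Qed.

(* A family of functions that contains [f], consists of differentiable functions
   and is stable, on [U], under directional derivatives. *)
Lemma smooth_on_class U (C : set (V -> W)) f : open U -> C f ->
  (forall g x, C g -> U x -> differentiable g x) ->
  (forall g v, C g -> exists2 h, C h & forall x, U x -> 'D_v g x = h x) ->
  smooth_on U f.
Proof.
move=> oU Cf Cd CD vs.
have [g Cg Ug] : exists2 g, C g & forall x, U x -> g x = iter_derive vs f x.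
  elim: vs => [|v vs [g Cg gE]]; first by exists f.
  have [h Ch hE] := CD g v Cg; exists h => // x Ux; rewrite -hE//=.
  apply: near_eq_derive.
  by apply: filterS (open_nbhs_nbhs (conj oU Ux)) => y /gE.
move=> x Ux; have [] // := @near_eq_differentiable _ _ _ g (iter_derive vs f) x.
  by apply: filterS (open_nbhs_nbhs (conj oU Ux)) => y /Ug.
exact: Cd.
Qed.

Lemma smooth_onD U f g : open U ->
  smooth_on U f -> smooth_on U g -> smooth_on U (f + g).
Proof.
move=> oU sf sg.
apply: (@smooth_on_class _ [set h | exists f g,
  [/\ smooth_on U f, smooth_on U g & h = f + g]]) => //.
- by exists f, g.
- move=> _ x [h [k [sh sk ->]]] Ux.
  by apply: differentiableD; apply: smooth_on_diff Ux.
- move=> _ v [h [k [sh sk ->]]]; exists ('D_v h + 'D_v k).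
    by exists ('D_v h), ('D_v k); split=> //; exact: smooth_on_derive.
  by move=> x Ux; rewrite deriveD//; apply: diff_derivable;
     apply: smooth_on_diff Ux.
Qed.

Lemma smooth_on_cst U w : open U -> smooth_on U (cst w : V -> W).
Proof.
move=> oU; apply: (@smooth_on_class _ [set h | exists w, h = cst w]) => //.
- by exists w.
- by move=> _ x [y ->] _.
- move=> _ v [y ->]; exists (cst 0); first by exists (0 : W).
  by move=> x _; rewrite derive_cst.
Qed.

Lemma smooth_on_sum U n (F : 'I_n -> V -> W) : open U ->
  (forall i, smooth_on U (F i)) -> smooth_on U (\sum_(i < n) F i).
Proof.
move=> oU sF; elim/big_ind: _ => //; first exact: smooth_on_cst.
by move=> *; exact: smooth_onD.
Qed.

Lemma smooth_on_linear (X : normedModType R) U f (l : {linear W -> X}) :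
  open U -> continuous l -> smooth_on U f -> smooth_on U (l \o f).
Proof.
move=> oU cl sf vs x Ux.
have dl y : differentiable l y by exact: linear_differentiable.
have E : forall y, U y -> l (iter_derive vs f y) = iter_derive vs (l \o f) y.
  elim: vs => // v vs IH y Uy.
  rewrite [RHS]/= -(@near_eq_derive _ _ _ (l \o iter_derive vs f)); last first.
    by apply: filterS (open_nbhs_nbhs (conj oU Uy)) => z /IH.
  have d := sf vs y Uy.
  rewrite (deriveE _ (differentiable_comp d (dl _))) diff_comp//= diff_lin//.
  by rewrite -deriveE.
have [] // := @near_eq_differentiable _ _ _ (l \o iter_derive vs f)
    (iter_derive vs (l \o f)) x.
  by apply: filterS (open_nbhs_nbhs (conj oU Ux)) => z /E.
exact: differentiable_comp (sf vs x Ux) (dl _).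
Qed.

Definition scale_fun (k : R) (w : W) : W := k *: w.

Lemma scale_fun_bilinear :
  bilinear_for
    (GRing.Scale.Law.clone _ _ *:%R _) (GRing.Scale.Law.clone _ _ *:%R _)
    scale_fun.
Proof.
rewrite /scale_fun; split=> [w|k] a x y /=.
  by rewrite scalerDl scalerA.
by rewrite scalerDr !scalerA mulrC.
Qed.
HB.instance Definition _ :=
  bilinear_isBilinear.Build R R W W _ _ scale_fun scale_fun_bilinear.

Lemma is_diff_scale (X : normedModType R) (k dk : X -> R) (f df : X -> W) x :
  is_diff x k dk -> is_diff x f df ->
  is_diff x (fun y => k y *: f y) (fun v => k x *: df v + dk v *: f x).
Proof.
move=> k' f'.
have c : continuous (fun p : R * W => scale_fun p.1 p.2).
  by move=> p; exact: scale_continuous.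
have d p : is_diff p (fun p : R * W => scale_fun p.1 p.2)
                     (fun q => p.1 *: q.2 + q.1 *: p.2).
  apply: DiffDef; first exact: differentiable_bilin.
  exact: diff_bilin.
rewrite (_ : (fun y => _) = (fun p : R * W => scale_fun p.1 p.2) \o
   (fun y => (k y, f y)))//.
exact: is_diff_eq.
Qed.
End SmoothCalculus.

Section SmoothTangentMap.
Context {R : realType} {n : nat} {W : normedModType R}.
Local Notation V := 'rV[R]_n.
Implicit Types (U : set V) (G H : V -> W).

Lemma fst_is_diff (z : V * V) : is_diff z (fst : V * V -> V) fst.
Proof.
have @f : {linear (V * V)%type -> V}.
  by exists (fun z : V * V => z.1); do 2![eexists]; do ?[constructor].
have cf : continuous f by move=> y; exact: cvg_fst.
apply: DiffDef; first exact: (linear_differentiable _ cf).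
exact: (diff_lin _ cf).
Qed.

Lemma comp_fst_is_diff G (z : V * V) : differentiable G z.1 ->
  is_diff z (G \o fst) ('d G (z.1) \o fst).
Proof.
move=> dG; apply: is_diff_comp; first exact: fst_is_diff.
exact: differentiableP.
Qed.

Lemma derive_fst G (z v : V * V) : differentiable G z.1 ->
  'D_v (G \o fst) z = 'D_(v.1) G z.1.
Proof.
move=> dG; have [d E] := comp_fst_is_diff dG.
by rewrite deriveE// E/= deriveE.
Qed.

Lemma coord_is_diff (i : 'I_n) (z : V * V) :
  is_diff z (fun z : V * V => z.2 ord0 i) (fun v => v.2 ord0 i).
Proof.
have @f : {linear (V * V)%type -> R}.
  by exists (fun z : V * V => z.2 ord0 i); do 2![eexists]; do ?[constructor];
     rewrite ?mxE// => ? *; rewrite ?mxE//; move=> ?; rewrite !mxE.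
have cf : continuous f.
  move=> y; apply: (@continuous_comp _ _ _ snd (fun u : V => u ord0 i)).
    exact: cvg_snd.
  exact: coord_continuous.
apply: DiffDef; first exact: (linear_differentiable _ cf).
exact: (diff_lin _ cf).
Qed.

Lemma smooth_on_term U G (i : 'I_n) : open U -> smooth_on U G ->
  smooth_on (fst @^-1` U) (fun z : V * V => z.2 ord0 i *: G z.1).
Proof.
move=> oU sG.
pose T G H := (fun z : V * V => z.2 ord0 i *: G z.1 + H z.1).
have dT G1 H1 z : differentiable G1 z.1 -> differentiable H1 z.1 ->
    is_diff z (T G1 H1) (fun v => z.2 ord0 i *: 'd G1 (z.1) v.1 +
      v.2 ord0 i *: G1 z.1 + 'd H1 (z.1) v.1).
  move=> dG dH.
  have := coord_is_diff i z.
  have a : is_diff z (G1 \o fst) ('d G1 (z.1) \o fst) by exact: comp_fst_is_diff.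
  have b : is_diff z (H1 \o fst) ('d H1 (z.1) \o fst) by exact: comp_fst_is_diff.
  move=> /is_diff_scale /(_ a) c.
  exact: is_diffD.
apply: (@smooth_on_class _ _ _ _ [set h | exists G H,
  [/\ smooth_on U G, smooth_on U H & h = T G H]]).
- by apply: open_comp => // z _; exact: cvg_fst.
- exists G, (cst 0); split=> //; first exact: smooth_on_cst.
  by apply/funext => z; rewrite /T /= addr0.
- move=> _ z [G1 [H1 [sG1 sH1 ->]]] Uz.
  by have [] := dT G1 H1 z (smooth_on_diff sG1 Uz) (smooth_on_diff sH1 Uz).
- move=> _ v [G1 [H1 [sG1 sH1 ->]]].
  exists (T ('D_(v.1) G1) (v.2 ord0 i *: G1 + 'D_(v.1) H1)).
    exists ('D_(v.1) G1), (v.2 ord0 i *: G1 + 'D_(v.1) H1); split=> //.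
      exact: smooth_on_derive.
    apply: smooth_onD => //; last exact: smooth_on_derive.
    apply: (@smooth_on_linear _ _ _ _ _ _ ( *:%R (v.2 ord0 i))) => //.
    exact: scaler_continuous.
  move=> z Uz; have dG := smooth_on_diff sG1 Uz; have dH := smooth_on_diff sH1 Uz.
  have [d E] := dT G1 H1 z dG dH.
  by rewrite (deriveE _ d) E /T !fctE !deriveE// addrA.
Qed.

Lemma smooth_on_fst U G : open U -> smooth_on U G ->
  smooth_on (fst @^-1` U : set (V * V)) (G \o fst).
Proof.
move=> oU sG.
apply: (@smooth_on_class _ _ _ _ [set h | exists2 G, smooth_on U G & h = G \o fst]).
- by apply: open_comp => // z _; exact: cvg_fst.
- by exists G.
- move=> _ z [G1 sG1 ->] Uz.
  by have [] := comp_fst_is_diff (smooth_on_diff sG1 Uz).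
- move=> _ v [G1 sG1 ->]; exists ('D_(v.1) G1 \o fst).
    by exists ('D_(v.1) G1) => //; exact: smooth_on_derive.
  by move=> z Uz; rewrite derive_fst//; exact: (smooth_on_diff sG1).
Qed.
End SmoothTangentMap.

Lemma smooth_on_tangent_map {R : realType} {n : nat} (U : set 'rV[R]_n)
    (f : 'rV[R]_n -> 'rV[R]_n) : open U -> smooth_on U f ->
  smooth_on (fst @^-1` U : set ('rV[R]_n * 'rV[R]_n))
    (fun z => (f z.1, 'd f (z.1) z.2)).
Proof.
move=> oU sf.
have oU2 : open (fst @^-1` U : set ('rV[R]_n * 'rV[R]_n)).
  by apply: open_comp => // z _; exact: cvg_fst.
pose i1 (w : 'rV[R]_n) : 'rV[R]_n * 'rV[R]_n := (w, 0).
pose i2 (w : 'rV[R]_n) : 'rV[R]_n * 'rV[R]_n := (0, w).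
have lin1 : linear i1.
  by move=> k x y; congr pair; rewrite /= scaler0 addr0.
have lin2 : linear i2.
  by move=> k x y; congr pair; rewrite /= scaler0 addr0.
pose inlM := GRing.isLinear.Build _ _ _ _ _ lin1.
pose inl : {linear _ -> _} := HB.pack i1 inlM.
pose inrM := GRing.isLinear.Build _ _ _ _ _ lin2.
pose inr : {linear _ -> _} := HB.pack i2 inrM.
have cl : continuous inl.
  by move=> x; apply: (differentiable_continuous (f := i1));
     apply: differentiable_pair.
have cr : continuous inr.
  by move=> x; apply: (differentiable_continuous (f := i2));
     apply: differentiable_pair.
apply: (@smooth_on_ext _ _ _ _ ((inl \o (f \o fst)) + (inr \o
    (\sum_(i < n) fun z : 'rV[R]_n * 'rV[R]_n =>
        z.2 ord0 i *: 'D_(delta_mx ord0 i) f z.1)))) => //.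
- move=> z Uz; have df := smooth_on_diff sf Uz.
  rewrite fctE /= fct_sumE /=.
  rewrite [in RHS](row_sum_delta z.2) linear_sum/=.
  congr pair; rewrite /= ?addr0 ?add0r//.
  by apply: eq_bigr => i _; rewrite linearZ deriveE.
- apply: smooth_onD => //; apply: smooth_on_linear => //.
    exact: smooth_on_fst.
  apply: smooth_on_sum => // i.
  exact: (smooth_on_term i oU (smooth_on_derive (delta_mx ord0 i) sf)).
Qed.

(* A smooth atlas on the set [M] modelled on [V]. Only the values of [param a]
   on the image of [dom a] are meaningful. *)
Record atlas (R : realType) (V : normedModType R) (M : Type) := Atlas {
  chart_id : Type;
   dom : chart_id -> set M;
  chart : chart_id -> M -> V;
  param : chart_id -> V -> M;
  dom_cover : forall p, exists a, dom a p;
  chartK : forall a p, dom a p -> param a (chart a p) = p;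
  overlap_open : forall a b, open (chart a @` (dom a `&` dom b));
  transition_smooth : forall a b,
    smooth_on (chart a @` (dom a `&` dom b)) (chart b \o param a)
}.
Arguments dom {R V M} A a : rename.
Arguments chart {R V M} A a : rename.
Arguments param {R V M} A a : rename.
Arguments transition_smooth {R V M} A a b : rename.
Arguments overlap_open {R V M} A a b : rename.

Section Tangent.
Context {R : realType} {V : normedModType R} {M : Type} (A : atlas V M).

Lemma dom_open a : open (chart A a @` dom A a).
Proof. by rewrite -(setIid (dom A a)); exact: overlap_open. Qed.

Lemma param_dom a z : (chart A a @` dom A a) z -> dom A a (param A a z).
Proof. by move=> [p ap <-]; rewrite chartK. Qed.

Lemma paramK a z : (chart A a @` dom A a) z -> chart A a (param A a z) = z.
Proof. by move=> [p ap <-]; rewrite chartK. Qed.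

Lemma transition_differentiable a b p : dom A a p -> dom A b p ->
  differentiable (chart A b \o param A a) (chart A a p).
Proof.
by move=> ap bp; apply: (smooth_on_diff (transition_smooth A a b)); exists p.
Qed.

Lemma transition_cocycle a b c p w : dom A a p -> dom A b p -> dom A c p ->
  'd (chart A c \o param A b) (chart A b p)
    ('d (chart A b \o param A a) (chart A a p) w)
  = 'd (chart A c \o param A a) (chart A a p) w.
Proof.
move=> ap bp cp.
have E : (chart A b \o param A a) (chart A a p) = chart A b p.
  by rewrite /= chartK.
have dab := transition_differentiable ap bp.
have dbc := transition_differentiable bp cp.
rewrite -E in dbc *.
have /(congr1 (fun h => h w)) /= <- := diff_comp dab dbc.
set f := (X in 'd X _ w = _).
have [||_ e] := @near_eq_differentiable _ _ _ f (chart A c \o param A a)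
  (chart A a p); last by rewrite e.
- have : nbhs (chart A a p) (chart A a @` (dom A a `&` dom A b)).
    by apply: open_nbhs_nbhs; split; [exact: overlap_open|exists p].
  by apply: filterS => _ [q [aq bq] <-]; rewrite /f /= !chartK.
- exact: differentiable_comp dab dbc.
Qed.

Lemma transition_id a p w : dom A a p ->
  'd (chart A a \o param A a) (chart A a p) w = w.
Proof.
move=> ap; have [||_ ->] := @near_eq_differentiable _ _ _
    id (chart A a \o param A a) (chart A a p).
- have : nbhs (chart A a p) (chart A a @` dom A a).
    by apply: open_nbhs_nbhs; split; [exact: dom_open|exists p].
  by apply: filterS => _ [q aq <-] /=; rewrite !chartK.
- exact: ex_diff.
- by rewrite diff_val.
Qed.

(* A tangent vector at [p] is the family of its components in the charts around
   [p], related by the differentials of the transition maps; the components in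
   the other charts are set to 0. *)
Definition tangent_comps (p : M) : {pred (chart_id A -> V)} := fun v =>
  `[< (forall a, ~ dom A a p -> v a = 0) /\
      (forall a b, dom A a p -> dom A b p ->
        v b = 'd (chart A b \o param A a) (chart A a p) (v a)) >].

Record tangent (p : M) := Tangent {
  tcomp : chart_id A -> V;
  tcompP : tcomp \in tangent_comps p
}.

HB.instance Definition _ p := [isSub for @tcomp p].
HB.instance Definition _ p := [Choice of tangent p by <:].

Lemma tangent_comps_submod p : submod_closed (tangent_comps p).
Proof.
split.
  by apply/asboolP; split=> [//|a b _ _ /=]; rewrite [RHS]linear0.
move=> k u v /asboolP[u0 uE] /asboolP[v0 vE]; apply/asboolP; split.
  by move=> a ap; rewrite !fctE u0// v0// scaler0 addr0.
move=> a b ap bp.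
by rewrite !fctE (uE a b)// (vE a b)// -linearP.
Qed.
HB.instance Definition _ p :=
  GRing.isSubmodClosed.Build R (chart_id A -> V) (tangent_comps p)
    (tangent_comps_submod p).
HB.instance Definition _ p := [SubChoice_isSubLmodule of tangent p by <:].

Definition tvec_comps a p w : chart_id A -> V := fun b =>
  if `[< dom A a p /\ dom A b p >]
  then 'd (chart A b \o param A a) (chart A a p) w else 0.

Lemma tvec_subproof a p w : tvec_comps a p w \in tangent_comps p.
Proof.
apply/asboolP; split=> [b bp|b c bp cp]; rewrite /tvec_comps.
  by case: asboolP => // -[].
case: (asboolP (_ /\ dom A c p)) => [[ap _]|nac].
  by case: asboolP => [_|[]//]; rewrite transition_cocycle.
by case: asboolP => [[ap _]|_]; [case: nac|rewrite linear0].
Qed.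

(* The tangent vector at [p] with components [w] in the chart [a]. *)
Definition tvec a p w : tangent p := Tangent (tvec_subproof a p w).

Lemma tcomp_tvec a p w : dom A a p -> tcomp (tvec a p w) a = w.
Proof.
by move=> ap /=; rewrite /tvec_comps; case: asboolP => [_|[]//];
   exact: transition_id.
Qed.

Lemma tvecK a p (v : tangent p) : dom A a p -> tvec a p (tcomp v a) = v.
Proof.
move=> ap; apply: val_inj; apply/funext => b /=; rewrite /tvec_comps.
have /asboolP[v0 vE] := tcompP v.
case: asboolP => [[_ bp]|nb]; first by rewrite -vE.
by rewrite v0// => bp; apply: nb.
Qed.

End Tangent.

Section TangentBundle.
Context {R : realType} {n : nat} {M : Type} (A : atlas 'rV[R]_n M).

Definition tbundle : Type := {p : M & tangent A p}.
Definition tau (v : tbundle) : M := projT1 v.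

(* The natural chart (q, u) of the tangent bundle induced by the chart [a]. *)
Definition tb_dom (a : chart_id A) : set tbundle := tau @^-1` dom A a.
Definition tb_chart (a : chart_id A) (v : tbundle) : 'rV[R]_n * 'rV[R]_n :=
  (chart A a (tau v), tcomp (projT2 v) a).
Definition tb_param (a : chart_id A) (z : 'rV[R]_n * 'rV[R]_n) : tbundle :=
  existT _ (param A a z.1) (tvec a (param A a z.1) z.2).

Lemma tb_cover v : exists a, tb_dom a v.
Proof. by have [a av] := dom_cover A (tau v); exists a. Qed.

Lemma tb_chartK a v : tb_dom a v -> tb_param a (tb_chart a v) = v.
Proof.
by case: v => p v ap; rewrite /tb_param /tb_chart /= chartK// tvecK.
Qed.

Lemma tb_overlap a b : tb_chart a @` (tb_dom a `&` tb_dom b) =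
  fst @^-1` (chart A a @` (dom A a `&` dom A b)).
Proof.
apply/seteqP; split=> [_ [v [av bv] <-]|z [p [ap bp] pz]]; first by exists (tau v).
have E : param A a z.1 = p by rewrite -pz chartK.
exists (tb_param a z); first by rewrite /tb_dom /tau /= E.
rewrite /tb_chart tcomp_tvec /tau /= E// pz.
by case: z {pz E}.
Qed.

Lemma tb_overlap_open a b : open (tb_chart a @` (tb_dom a `&` tb_dom b)).
Proof.
rewrite tb_overlap; apply: open_comp; first by move=> z _; exact: cvg_fst.
exact: overlap_open.
Qed.

Lemma tb_transition_smooth a b :
  smooth_on (tb_chart a @` (tb_dom a `&` tb_dom b)) (tb_chart b \o tb_param a).
Proof.
have := @tb_overlap_open a b; rewrite tb_overlap => o.
apply: smooth_on_ext o _ (smooth_on_tangent_map (overlap_open A a b)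
  (transition_smooth A a b)).
move=> [_ u] [p [ap bp] /= <-]; rewrite /tb_chart /tau /=.
rewrite /tvec_comps chartK//.
by case: asboolP => // -[].
Qed.

Definition tb_atlas : atlas ('rV[R]_n * 'rV[R]_n)%type tbundle :=
  Atlas tb_cover tb_chartK tb_overlap_open tb_transition_smooth.

End TangentBundle.

(* [W] is open for the topology determined by the atlas. *)
Definition aopen (R : realType) (V : normedModType R) (M : Type)
    (A : atlas V M) (W : set M) : Prop :=
  forall a, open (chart A a @` (W `&` dom A a)).

Record smoothManifold (R : realType) (n : nat) := SmoothManifold {
  carrier :> topologicalType;
  matlas :> atlas 'rV[R]_n carrier;
  manifold_openE : forall W : set carrier, open W <-> aopen matlas W;
  manifold_hausdorff : hausdorff_space carrier;
  manifold_second_countable : @second_countable carrier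
}.

(* An element [a] of [chart_id A] is a chart. The operations with an argument
   [a] are given by their expression in that chart; they are meaningful at the
   points of the domain of [a]. On smooth objects they do not depend on [a],
   provided, for those that involve the connection, that [Gamma] is a second
   order equation field, as it is for the Euler-Lagrange field of a regular
   Lagrangian.

   Vector fields are total functions required to be smooth on an open set [W],
   so that local vector fields are covered as well as global ones ([W = setT]). *)
Section Calculus.
Context {R : realType} {V : normedModType R} {M : Type} (A : atlas V M).

Definition smooth_fun (F : M -> R) : Prop :=
  forall a, smooth_on (chart A a @` dom A a) (F \o param A a).

Definition vfield : Type := forall p : M, tangent A p.
Definition form1 : Type := forall p : M, tangent A p -> R.
Definition tensor11 : Type := forall p : M, {linear tangent A p -> tangent A p}.

Definition vf_rep (a : chart_id A) (xi : vfield) (z : V) : V :=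
  tcomp (xi (param A a z)) a.

(* [xi] is a smooth vector field on the open set [W]. *)
Definition smooth_vf (W : set M) (xi : vfield) : Prop :=
  forall a, smooth_on (chart A a @` (W `&` dom A a)) (vf_rep a xi).

Definition smooth_tensor11 (K : tensor11) : Prop :=
  forall a w, smooth_on (chart A a @` dom A a)
    (fun z => tcomp (K (param A a z) (tvec a (param A a z) w)) a).

(* dF(xi) = xi(F) *)
Definition dfun (a : chart_id A) (F : M -> R) : form1 := fun p xi =>
  'D_(tcomp xi a) (F \o param A a) (chart A a p).

Definition bracket (a : chart_id A) (xi eta : vfield) : vfield := fun p =>
  let z := chart A a p in
  tvec a p ('D_(vf_rep a xi z) (vf_rep a eta) z
            - 'D_(vf_rep a eta z) (vf_rep a xi) z).

Definition form_rep (a : chart_id A) (alpha : form1) (w z : V) : R :=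
  alpha (param A a z) (tvec a (param A a z) w).

(* (d alpha)(xi, eta), normalised so that
   (d alpha)(X, Y) = X(alpha Y) - Y(alpha X) - alpha [X, Y]. *)
Definition dform (a : chart_id A) (alpha : form1) (p : M) (xi eta : tangent A p) :
    R :=
  'D_(tcomp xi a) (form_rep a alpha (tcomp eta a)) (chart A a p)
  - 'D_(tcomp eta a) (form_rep a alpha (tcomp xi a)) (chart A a p).

(* d_K F = dF o K *)
Definition d_op (a : chart_id A) (K : forall p, tangent A p -> tangent A p)
    (F : M -> R) : form1 := fun p xi => dfun a F (K p xi).

End Calculus.

Section TangentBundleGeometry.
Context {R : realType} {n : nat} {M : Type} (A : atlas 'rV[R]_n M).
Local Notation TM := (tbundle A).
Local Notation TA := (tb_atlas A).
Implicit Types (a : chart_id A) (v : TM).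

Definition vlift a v (w : tangent A (tau v)) : tangent TA v :=
  tvec (A := TA) a v (0, tcomp w a).

Definition clift a (X : vfield A) v : tangent TA v :=
  let q := chart A a (tau v) in
  tvec (A := TA) a v (vf_rep a X q, 'D_(tcomp (projT2 v) a) (vf_rep a X) q).

Definition is_complete_lift (J : tensor11 A) (Jc : tensor11 TA) : Prop :=
  forall (W : set M) (X : vfield A), aopen A W -> smooth_vf W X ->
  forall a v, W (tau v) -> dom A a (tau v) ->
    Jc v (clift a X v) = clift a (fun p => J p (X p)) v /\
    Jc v (vlift a (X (tau v))) = vlift a (J (tau v) (X (tau v))).

(* S = d/du^i (x) dq^i *)
Definition vert_endo a v (xi : tangent TA v) : tangent TA v :=
  tvec (A := TA) a v (0, (tcomp xi a).1).

(* Delta = u^i d/du^i *)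
Definition liouville a : vfield TA := fun v =>
  tvec (A := TA) a v (0, tcomp (projT2 v) a).

Definition hessian a (L : TM -> R) v : 'M[R]_n :=
  \matrix_(i, j) 'D_(0, delta_mx ord0 i)
    ('D_(0, delta_mx ord0 j) (L \o param TA a)) (chart TA a v).

Definition regular (L : TM -> R) : Prop :=
  forall a v, dom TA a v -> hessian a L v \in unitmx.

Definition theta a (L : TM -> R) : form1 TA :=
  d_op (A := TA) a (vert_endo a) L.

Definition energy a (L : TM -> R) v : R :=
  dfun (A := TA) a L (liouville a v) - L v.

Definition is_euler_lagrange_field (L : TM -> R) (Gamma : vfield TA) : Prop :=
  forall a v, dom TA a v -> forall eta : tangent TA v,
    dform (A := TA) a (theta a L) (Gamma v) eta
    = - dfun (A := TA) a (energy a L) eta.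

(* Objects along tau. *)

Definition vfield_along : Type := forall v : TM, tangent A (tau v).
Definition form1_along : Type := forall v : TM, tangent A (tau v) -> R.
Definition tensor11_along : Type :=
  forall v : TM, {linear tangent A (tau v) -> tangent A (tau v)}.

Definition smooth_vf_along (W : set TM) (X : vfield_along) : Prop :=
  forall a, smooth_on (chart TA a @` (W `&` dom TA a))
    (fun z => tcomp (X (param TA a z)) a).

Definition smooth_tensor11_along (K : tensor11_along) : Prop :=
  forall a w, smooth_on (chart TA a @` dom TA a)
    (fun z => tcomp (K (param TA a z) (tvec a (tau (param TA a z)) w)) a).

Definition along (J : tensor11 A) : tensor11_along := fun v => J (tau v).

Definition act (K : tensor11_along) (X : vfield_along) : vfield_along :=
  fun v => K v (X v).

Definition vfield_vlift a (X : vfield_along) : vfield TA := fun v => vlift a (X v).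

(* theta_L as a form along tau: theta_L(X) = D^V_X L *)
Definition theta_along a (L : TM -> R) : form1_along := fun v w =>
  dfun (A := TA) a L (vlift a w).

(* J theta_L *)
Definition Jtheta a (J : tensor11 A) (L : TM -> R) : form1_along := fun v w =>
  theta_along a L (J (tau v) w).

Section Connection.
Variable Gamma : vfield TA.

(* The entry (j, i) is Gamma^i_j = - 1/2 df^i/du^j. *)
Definition conn a v : 'M[R]_n :=
  \matrix_(j, i) (- 2^-1 * 'D_(0, delta_mx ord0 j)
    (fun z => (vf_rep (A := TA) a Gamma z).2 ord0 i) (chart TA a v)).

Definition hlift a v (w : tangent A (tau v)) : tangent TA v :=
  tvec (A := TA) a v (tcomp w a, - (tcomp w a *m conn a v)).

Definition vfield_hlift a (X : vfield_along) : vfield TA := fun v => hlift a (X v).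

(* zeta = (hpart zeta)^H + (vpart zeta)^V, see [hvpartK] *)
Definition hpart a v (zeta : tangent TA v) : tangent A (tau v) :=
  tvec a (tau v) (tcomp zeta a).1.
Definition vpart a v (zeta : tangent TA v) : tangent A (tau v) :=
  tvec a (tau v) (tcomp (zeta - hlift a (hpart a zeta)) a).2.

Lemma hvpartK a v (zeta : tangent TA v) : dom TA a v ->
  zeta = hlift a (hpart a zeta) + vlift a (vpart a zeta).
Proof.
move=> av; apply/eqP; rewrite addrC -subr_eq; apply/eqP.
rewrite -[LHS](tvecK _ av) /vlift /vpart; congr tvec.
rewrite (tcomp_tvec (A := A) _ av) [LHS]surjective_pairing; congr pair.
have -> : tcomp (zeta - hlift a (hpart a zeta)) a =
  tcomp zeta a - tcomp (hlift a (hpart a zeta)) a by [].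
by rewrite /hlift (tcomp_tvec (A := TA) _ av) (tcomp_tvec (A := A) _ av)/= subrr.
Qed.

(* D^H_X Y and D^V_Y X, as determined by [X^H, Y^V], see [bracketHV] *)
Definition covH a (X Y : vfield_along) : vfield_along := fun v =>
  vpart a (bracket (A := TA) a (vfield_hlift a X) (vfield_vlift a Y) v).
Definition covV a (Y X : vfield_along) : vfield_along := fun v =>
  - hpart a (bracket (A := TA) a (vfield_hlift a X) (vfield_vlift a Y) v).

Lemma bracketHV a X Y v : dom TA a v ->
  bracket (A := TA) a (vfield_hlift a X) (vfield_vlift a Y) v
  = vlift a (covH a X Y v) - hlift a (covV a Y X v).
Proof.
move=> av; rewrite [LHS](hvpartK _ av) addrC; congr (_ + _).
have hN w : hlift a (- w) = - hlift a w :> tangent TA v.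
  rewrite -[RHS](tvecK _ av) [LHS]/hlift; congr tvec.
  rewrite -[tcomp (- hlift a w) a]/(- tcomp (hlift a w) a) /hlift tcomp_tvec//.
  rewrite -[tcomp (- w) a]/(- tcomp w a) mulNmx.
  by congr pair.
by rewrite /covV hN opprK.
Qed.

(* (D^H_X alpha)(Y) and (D^V_X alpha)(Y) *)
Definition covH_form a (X : vfield_along) (alpha : form1_along)
    (Y : vfield_along) v : R :=
  dfun (A := TA) a (fun v => alpha v (Y v)) (hlift a (X v))
  - alpha v (covH a X Y v).
Definition covV_form a (X : vfield_along) (alpha : form1_along)
    (Y : vfield_along) v : R :=
  dfun (A := TA) a (fun v => alpha v (Y v)) (vlift a (X v))
  - alpha v (covV a X Y v).

Definition dH a (alpha : form1_along) (X Y : vfield_along) v : R :=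
  covH_form a X alpha Y v - covH_form a Y alpha X v.

(* g(X, Y) for g = D^V D^V L *)
Definition metric a (L : TM -> R) (X Y : vfield_along) v : R :=
  covV_form a X (theta_along a L) Y v.

End Connection.
End TangentBundleGeometry.

(* Main.v *)
Require Import Defs.
From HB Require Import structures.
From mathcomp Require Import all_boot all_order all_algebra.
From mathcomp Require Import all_classical all_reals all_analysis.
From mathcomp Require Import ring lra.
Import Order.TTheory GRing.Theory Num.Theory.
Import numFieldNormedType.Exports.
Set Implicit Arguments.
Unset Strict Implicit.
Unset Printing Implicit Defensive.
Local Open Scope classical_set_scope.
Local Open Scope ring_scope.

(** The identities are pointwise, so they are read off in a natural chart
    [(q, u)]. Let [l] be the local expression of [L], let [B(v, w)] be its second
    derivative at the point considered, and write tangent vectors as pairs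
    [xi = (xi1, xi2)]. The metric is [g(x, y) = B((0, x), (0, y))], and the
    symplectic form is

      omega(xi, eta) = B(xi, (0, eta1)) - B(eta, (0, xi1)),

    which is nondegenerate because [g] is ([omega_nondegenerate]). Similarly, with
    [A_y] the function [(J theta_L)(y)] for constant [y],

      (d d_(J^c S) L)(xi, eta) = xi(A_(eta1)) - eta(A_(xi1)).

    It suffices to evaluate both sides of the claimed formulas by [omega] against
    every [eta].

    If [xi = (0, x)], the last expression reduces to [g(x, J eta1)], because [J]
    is constant along the fibres, and [g(x, J eta1)] is
    [g(Jbar x, eta1) = omega((0, Jbar x), eta)]; this is [recursion_vertical].

    If [xi = x^H], it is enough to take [eta] vertical or [eta = y^H]. In the
    vertical case [(0, e)] both sides are [- g(e, J x)]. In the horizontal case the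
    left-hand side is [x^H(A_y) - y^H(A_x)], which is [d^H(J theta_L)(x, y)] since
    the connection is torsion free ([dH_chart]), that is, [g(U x, y)]. The
    right-hand side is [omega((J x)^H, y^H) + g(U x, y)]. The first term vanishes:
    horizontal vectors are [omega]-orthogonal to each other
    ([horizontal_lagrangian]), as one sees by deriving the Euler-Lagrange
    equations in a vertical direction and antisymmetrizing. Hence
    [recursion_horizontal].

    The symmetry of second derivatives is used throughout
    ([smooth_derive_comm]). The hypotheses on tensors are stated for smooth vector
    fields; they are applied to fields with constant components in the chart,
    whose smoothness in the other charts rests on the composition of smooth maps
    ([smooth_on_comp], [smooth_coordinate_field]). *)

(** * Symmetry of second derivatives *)

Section Schwarz.
Context {R : realType} {V : normedModType R}.
Implicit Types (U : set V) (f : V -> R).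

Lemma is_diff_add_cst {W : normedModType R} (f : V -> W) (a x : V) :
  differentiable f (x + a) -> is_diff x (fun y => f (y + a)) ('d f (x + a)).
Proof.
move=> df; have da : is_diff x (fun y : V => y + a) id.
  by apply: is_diff_eq => //; rewrite addr0.
have db : is_diff (x + a) f ('d f (x + a)) by exact: differentiableP.
exact: (@is_diff_comp _ _ _ _ _ _ _ _ x da db).
Qed.

Lemma derive_add_cst {W : normedModType R} (f : V -> W) (a x v : V) :
  differentiable f (x + a) ->
  'D_v (fun y => f (y + a)) x = 'D_v f (x + a).
Proof.
move=> df; have [d E] := is_diff_add_cst df.
by rewrite (deriveE _ d) E deriveE.
Qed.

Lemma is_derive_line f (y v : V) (t : R) : differentiable f (y + t *: v) ->
  is_derive t 1 (fun t => f (y + t *: v)) ('D_v f (y + t *: v)).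
Proof.
move=> df.
have dl : is_diff t (fun t : R => y + t *: v) (fun t => t *: v).
  by apply: is_diff_eq => //; rewrite add0r.
have db : is_diff (y + t *: v) f ('d f (y + t *: v)) by exact: differentiableP.
have [d E] := @is_diff_comp _ _ _ _ _ _ _ _ t dl db.
apply: DeriveDef; first exact: diff_derivable.
by rewrite (deriveE _ d) E /= scale1r deriveE.
Qed.

Lemma MVT_line f (y v : V) (h : R) : 0 < h ->
  (forall t, 0 <= t <= h -> differentiable f (y + t *: v)) ->
  exists2 t, 0 <= t <= h & f (y + h *: v) - f y = h * 'D_v f (y + t *: v).
Proof.
move=> h0 df; pose phi t := f (y + t *: v).
have dphi t : 0 <= t <= h -> is_derive t 1 phi ('D_v f (y + t *: v)).
  by move=> /df; exact: is_derive_line.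
have [||t] := @MVT_segment R phi (fun t => 'D_v f (y + t *: v)) 0 h (ltW h0).
- by move=> t; rewrite in_itv /= => /andP[t0 th]; apply: dphi; rewrite !ltW.
- apply: derivable_within_continuous => t; rewrite in_itv /= => th.
  by have [] := dphi t th.
- rewrite in_itv /= /phi scale0r addr0 subr0 => th ->.
  by exists t => //; rewrite mulrC.
Qed.

(** The mean value theorem is applied in the direction [v] to
    [y |-> f (y + h w) - f y], and then in the direction [w] to ['D_v f]. *)
Lemma second_difference U f (x v w : V) (h : R) : smooth_on U f -> 0 < h ->
  (forall s t, 0 <= s <= h -> 0 <= t <= h -> U (x + s *: v + t *: w)) ->
  exists s t, [/\ 0 <= s <= h, 0 <= t <= h &
    f (x + h *: v + h *: w) - f (x + h *: v) - f (x + h *: w) + f x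
    = h * (h * 'D_w ('D_v f) (x + s *: v + t *: w))].
Proof.
move=> sf h0 Uh; have hh : 0 <= h <= h by rewrite lexx ltW.
have h00 : 0 <= (0 : R) <= h by rewrite lexx ltW.
have Uh0 s : 0 <= s <= h -> U (x + s *: v).
  by move=> /Uh/(_ h00); rewrite scale0r addr0.
pose F y := f (y + h *: w) - f y.
have df1 y : U (y + h *: w) -> differentiable (fun y => f (y + h *: w)) y.
  by move=> Uy; have [] := is_diff_add_cst (smooth_on_diff sf Uy).
have dF s : 0 <= s <= h -> differentiable F (x + s *: v).
  move=> sh; apply: differentiableB; first by apply: df1; exact: Uh.
  by apply: smooth_on_diff sf _; exact: Uh0.
have [s sh Es] := MVT_line h0 dF.
have [|t th Et] := @MVT_line ('D_v f) (x + s *: v) w h h0.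
  by move=> t th; apply: (sf [:: v]); exact: Uh.
exists s, t; split => //; rewrite -Et.
transitivity (F (x + h *: v) - F x).
  by rewrite /F opprB addrA (addrAC _ _ (f x)); congr (_ + _).
have Us := Uh s h sh hh; have Us0 := Uh0 s sh.
rewrite Es deriveB ?derive_add_cst//; first exact: smooth_on_diff sf Us.
  by apply: diff_derivable; exact: df1.
by apply: diff_derivable; exact: smooth_on_diff sf Us0.
Qed.

(** Schwarz's theorem. The second difference of [f] is symmetric in [v] and
    [w], and by [second_difference] it is [h ^ 2] times a value, near [x], of
    either of the two iterated derivatives; both are continuous at [x]. *)
Lemma smooth_derive_comm U f (x v w : V) : open U -> smooth_on U f -> U x ->
  'D_v ('D_w f) x = 'D_w ('D_v f) x.
Proof.
move=> oU sf Ux; apply/eqP; rewrite -subr_eq0 -normr_le0.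
apply/ler_addgt0Pl => e e0; rewrite addr0.
have e20 : 0 < e / 2 by rewrite divr_gt0.
have cont v1 v2 : \forall y \near x, U y /\
    `|'D_v1 ('D_v2 f) x - 'D_v1 ('D_v2 f) y| < e / 2.
  have c : {for x, continuous ('D_v1 ('D_v2 f))}.
    exact: differentiable_continuous (sf [:: v1; v2] x Ux).
  have H := cvgr_dist_lt _ _ c _ e20.
  have N := open_nbhs_nbhs (conj oU Ux).
  apply: filterI; [exact: N|exact: H].
have : \forall y \near x, [/\ U y,
    `|'D_v ('D_w f) x - 'D_v ('D_w f) y| < e / 2 &
    `|'D_w ('D_v f) x - 'D_w ('D_v f) y| < e / 2].
  by apply: filterS (filterI (cont v w) (cont w v)) => y [[? ?] []].
move=> /nbhs_ballP[d /= d0 H].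
(* small enough for the parallelogram spanned by h v and h w at x to lie in
   the ball of radius d *)
pose h := d / (`|v| + `|w| + 1).
have N0 : 0 < `|v| + `|w| + 1 by rewrite ltr_wpDl// addr_ge0.
have h0 : 0 < h by rewrite divr_gt0.
have Bh s t : 0 <= s <= h -> 0 <= t <= h -> ball x d (x + s *: v + t *: w).
  move=> /andP[s0 sh] /andP[t0 th].
  rewrite -ball_normE /= -addrA opprD addNKr normrN.
  apply: (le_lt_trans (ler_normD _ _)); rewrite !normrZ !ger0_norm//.
  apply: (@le_lt_trans _ _ (h * (`|v| + `|w|))).
    by rewrite mulrDr lerD// ler_wpM2r.
  by rewrite /h mulrAC -mulrA gtr_pMr// ltr_pdivrMr// mul1r ltrDl.
have Bh' s t : 0 <= s <= h -> 0 <= t <= h -> ball x d (x + s *: w + t *: v).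
  by move=> sh th; rewrite addrAC; exact: Bh.
have [s [t [sh th E]]] := second_difference sf h0
  (fun s t sh th => let: And3 a _ _ := H _ (Bh s t sh th) in a).
have [s' [t' [sh' th' E']]] := second_difference sf h0
  (fun s t sh th => let: And3 a _ _ := H _ (Bh' s t sh th) in a).
have EE : 'D_w ('D_v f) (x + s *: v + t *: w) =
          'D_v ('D_w f) (x + s' *: w + t' *: v).
  apply: (mulfI (lt0r_neq0 h0)); apply: (mulfI (lt0r_neq0 h0)).
  apply: (etrans (esym E)); apply: (etrans _ E').
  by rewrite (addrAC x (h *: w)); congr (_ + _); exact: addrAC.
have [_ _ A] := H _ (Bh s t sh th); have [_ B _] := H _ (Bh' s' t' sh' th').
rewrite EE in A.
rewrite (_ : _ - _ = ('D_v ('D_w f) x - 'D_v ('D_w f) (x + s' *: w + t' *: v)) -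
  ('D_w ('D_v f) x - 'D_v ('D_w f) (x + s' *: w + t' *: v)));
  last by rewrite opprB addrA subrK.
apply: (le_trans (ler_normB _ _)); rewrite [leRHS]splitr.
exact: (lerD (ltW B) (ltW A)).
Qed.

End Schwarz.

(** * Smooth maps between finite dimensional spaces *)

Section SmoothProduct.
Context {R : realType} {V W : normedModType R}.
Implicit Types (U : set V) (k : V -> R) (f : V -> W).

Lemma is_diff_scalef k f x : differentiable k x -> differentiable f x ->
  is_diff x (fun y => k y *: f y) (fun v => k x *: 'd f x v + 'd k x v *: f x).
Proof.
by move=> dk df; apply: is_diff_scale; exact: differentiableP.
Qed.

Lemma derive_scalef k f x v : differentiable k x -> differentiable f x ->
  'D_v (fun y => k y *: f y) x = k x *: 'D_v f x + 'D_v k x *: f x.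
Proof.
move=> dk df; have [d E] := is_diff_scalef dk df.
by rewrite (deriveE _ d) E !deriveE.
Qed.

(** Closure of [C] under sums and products by smooth scalars. The Leibniz rule
    propagates through such combinations, so that only the derivatives of the
    members of [C] have to be known to be combinations again. *)
Inductive smooth_combination U (C : set (V -> W)) : (V -> W) -> Prop :=
| comb_base f : C f -> smooth_combination U C f
| comb_add f g : smooth_combination U C f -> smooth_combination U C g ->
    smooth_combination U C (f + g)
| comb_scale k f : smooth_on U k -> smooth_combination U C f ->
    smooth_combination U C (fun y => k y *: f y).

Lemma smooth_on_combination U (C : set (V -> W)) f : open U ->
  (forall g x, C g -> U x -> differentiable g x) ->
  (forall g v, C g -> exists2 h, smooth_combination U C h &
    forall x, U x -> 'D_v g x = h x) ->
  smooth_combination U C f -> smooth_on U f.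
Proof.
move=> oU Cd CD Cf.
have diffC g x : smooth_combination U C g -> U x -> differentiable g x.
  move=> + Ux; elim=> {g} [g Cg|g h _ dg _ dh|k g sk _ dg]; first exact: Cd.
    exact: differentiableD.
  by have [] := is_diff_scalef (smooth_on_diff sk Ux) dg.
apply: (smooth_on_class oU Cf) => // g v.
elim=> {g} [g Cg|g h Cg [g' Cg' g'E] Ch [h' Ch' h'E]|k g sk Cg [g' Cg' g'E]].
- exact: CD.
- exists (g' + h'); first exact: comb_add.
  move=> x Ux; rewrite deriveD ?g'E ?h'E//; apply: diff_derivable; exact: diffC Ux.
- exists ((fun y => k y *: g' y) + (fun y => 'D_v k y *: g y)).
    apply: comb_add; apply: comb_scale => //; exact: smooth_on_derive.
  move=> x Ux; rewrite derive_scalef ?g'E//; first exact: smooth_on_diff sk Ux.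
  exact: diffC Ux.
Qed.

End SmoothProduct.

(** A finite family of vectors with continuous coordinate functionals. It stands
    for finite dimensionality and serves both for row vectors and for pairs of
    row vectors, the two models of charts. *)
Record frame (R : realType) (V : normedModType R) := Frame {
  frame_dim : nat;
  frame_vec : 'I_frame_dim -> V;
  frame_coord : 'I_frame_dim -> {linear V -> R};
  frame_coord_continuous : forall i, continuous (frame_coord i);
  frameE : forall v, v = \sum_i frame_coord i v *: frame_vec i }.

Section Frames.
Context {R : realType} {V W X : normedModType R} (F : frame W).
Local Notation e := (frame_vec (f := F)).
Local Notation c := (frame_coord (f := F)).

Lemma frame_coord_differentiable (w : V -> W) i x : differentiable w x ->
  differentiable (c i \o w) x.
Proof.
move=> dw; apply: differentiable_comp => //.
exact: (linear_differentiable _ (@frame_coord_continuous _ _ F i)).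
Qed.

Lemma derive_frame_coord (w : V -> W) i x v : differentiable w x ->
  'D_v (c i \o w) x = c i ('D_v w x).
Proof.
move=> dw; have dc y := linear_differentiable y (@frame_coord_continuous _ _ F i).
rewrite (deriveE _ (frame_coord_differentiable i dw)) diff_comp// /=.
by rewrite (diff_lin _ (@frame_coord_continuous _ _ F i)) deriveE.
Qed.

Lemma derive_frame (f : W -> X) x w : differentiable f x ->
  'D_w f x = \sum_i c i w *: 'D_(e i) f x.
Proof.
move=> df; rewrite deriveE// {1}(frameE F w) linear_sum.
by apply: eq_bigr => i _; rewrite linearZ deriveE.
Qed.

(** By the chain rule, the derivative of [f \o g] is a combination, with the
    smooth coefficients [frame_coord i ('D_v g)], of the functions
    ['D_(frame_vec i) f \o g], which are of the same form. *)
Lemma smooth_on_comp (U : set V) (U' : set W) (g : V -> W) (f : W -> X) :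
  open U -> open U' -> (forall x, U x -> U' (g x)) ->
  smooth_on U g -> smooth_on U' f ->
  smooth_on U (f \o g).
Proof.
move=> oU oU' gU sg sf.
pose C (h : V -> X) := exists2 f, smooth_on U' f & h = f \o g.
apply: (@smooth_on_combination R V X U C) => //.
- move=> _ x [f1 sf1 ->] Ux; apply: differentiable_comp.
    exact: smooth_on_diff sg Ux.
  by apply: smooth_on_diff sf1 _; exact: gU.
- move=> _ v [f1 sf1 ->].
  exists (\sum_i fun y => (c i \o 'D_v g) y *: ('D_(e i) f1 \o g) y).
    elim/big_ind: _ => //.
    + apply: comb_base; exists (cst 0); last by apply/funext.
      exact: smooth_on_cst.
    + by move=> ? ? ? ?; exact: comb_add.
    + move=> i _; apply: comb_scale.
        apply: smooth_on_linear => //; first exact: frame_coord_continuous.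
        exact: smooth_on_derive.
      by apply: comb_base; exists ('D_(e i) f1) => //; exact: smooth_on_derive.
  move=> x Ux; have dg := smooth_on_diff sg Ux.
  have df1 := smooth_on_diff sf1 (gU _ Ux).
  rewrite (deriveE _ (differentiable_comp dg df1)) diff_comp//= -!deriveE//.
  by rewrite derive_frame// fct_sumE.
- by apply: comb_base; exists f.
Qed.

End Frames.

Section DeriveAlong.
Context {R : realType} {W X : normedModType R} (F : frame W).
Local Notation e := (frame_vec (f := F)).
Local Notation c := (frame_coord (f := F)).

(** The product rule for the derivative of [f] in a direction [w y] that varies
    with the point. *)
Lemma derive_along (U : set W) (f : W -> X) (w : W -> W) x :
  open U -> smooth_on U f -> U x -> differentiable w x ->
  differentiable (fun y => 'D_(w y) f y) x /\
  forall v, 'D_v (fun y => 'D_(w y) f y) x =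
    'D_v ('D_(w x) f) x + 'D_('D_v w x) f x.
Proof.
move=> oU sf Ux dw.
pose h := \sum_i fun y => (c i \o w) y *: 'D_(e i) f y.
have near_h (g : W -> W) : \forall y \near x,
    (\sum_i fun y => (c i \o g) y *: 'D_(e i) f y) y = 'D_(g y) f y.
  apply: filterS (open_nbhs_nbhs (conj oU Ux)) => y Uy.
  by rewrite (derive_frame F) ?fct_sumE//; exact: smooth_on_diff sf Uy.
have dcw i := frame_coord_differentiable (F := F) i dw.
have dDf i : differentiable ('D_(e i) f) x by exact: (sf [:: e i]).
have dt i : differentiable (fun y => (c i \o w) y *: 'D_(e i) f y) x.
  by have [] := is_diff_scalef (dcw i) (dDf i).
have dh : differentiable h x by exact: differentiable_sum.
have [d dE] := near_eq_differentiable (near_h w) dh.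
split=> // v; rewrite -(near_eq_derive v (near_h w)).
rewrite derive_sum; last by move=> i; exact: diff_derivable.
under eq_bigr do rewrite derive_scalef// derive_frame_coord//.
rewrite big_split /= -(derive_frame F ('D_v w x) (smooth_on_diff sf Ux)).
congr (_ + _); rewrite -(near_eq_derive v (near_h (cst (w x)))).
rewrite derive_sum; last first.
  move=> i; apply: diff_derivable; exact: (differentiableZ (c i (w x)) (dDf i)).
apply: eq_bigr => i _; rewrite -(deriveZ (c i (w x)))//.
exact: diff_derivable.
Qed.

End DeriveAlong.

Section PairDerivative.
Context {R : realType} {V W X : normedModType R}.

Lemma fst_is_diff (z : V * W) : is_diff z fst fst.
Proof.
have @f : {linear (V * W)%type -> V}.
  by exists (fun z : V * W => z.1); do 2![eexists]; do ?[constructor].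
have cf : continuous f by move=> y; exact: cvg_fst.
apply: DiffDef; first exact: (linear_differentiable _ cf).
exact: (diff_lin _ cf).
Qed.

Lemma snd_is_diff (z : V * W) : is_diff z snd snd.
Proof.
have @f : {linear (V * W)%type -> W}.
  by exists (fun z : V * W => z.2); do 2![eexists]; do ?[constructor].
have cf : continuous f by move=> y; exact: cvg_snd.
apply: DiffDef; first exact: (linear_differentiable _ cf).
exact: (diff_lin _ cf).
Qed.

Lemma derive_pair (f : X -> V) (g : X -> W) x v :
  differentiable f x -> differentiable g x ->
  'D_v (fun y => (f y, g y)) x = ('D_v f x, 'D_v g x).
Proof.
move=> df dg; rewrite (deriveE _ (differentiable_pair df dg)).
by rewrite diff_pair//= -!deriveE.
Qed.

Lemma smooth_on_snd (U : set X) (f : X -> V * W) : open U ->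
  smooth_on U f -> smooth_on U (snd \o f).
Proof.
move=> oU sf.
have @p : {linear (V * W)%type -> W}.
  by exists (fun z : V * W => z.2); do 2![eexists]; do ?[constructor].
have cp : continuous p by move=> y; exact: cvg_snd.
exact: (smooth_on_linear oU cp sf).
Qed.

(** The vectors of [F] come first, those of [G] after them. *)
Definition pair_frame (F : frame V) (G : frame W) : frame (V * W)%type.
Proof.
pose d := (frame_dim F + frame_dim G)%N.
pose e (i : 'I_d) : V * W := match fintype.split i with
  | inl j => (frame_vec j, 0) | inr j => (0, frame_vec j) end.
pose c (i : 'I_d) (z : V * W) : R := match fintype.split i with
  | inl j => frame_coord j z.1 | inr j => frame_coord j z.2 end.
have cl i : linear (c i).
  by move=> k x y; rewrite /c; case: fintype.split => j; exact: linearP.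
pose cL i : {linear (V * W)%type -> R} :=
  HB.pack (c i) (GRing.isLinear.Build _ _ _ _ _ (cl i)).
apply: (@Frame R (V * W)%type d e cL).
- move=> i z; rewrite /cL /= /c; case: fintype.split => j.
    apply: (@continuous_comp _ _ _ fst (frame_coord j)); first exact: cvg_fst.
    exact: frame_coord_continuous.
  apply: (@continuous_comp _ _ _ snd (frame_coord j)); first exact: cvg_snd.
  exact: frame_coord_continuous.
- move=> z; rewrite big_split_ord /=.
  under eq_bigr do rewrite /c /e (unsplitK (inl _)).
  under [in X in _ = _ + X]eq_bigr do rewrite /c /e (unsplitK (inr _)).
  have E1 (I : finType) (k : I -> R) (u : I -> V) :
      \sum_i k i *: (u i, 0 : W) = (\sum_i k i *: u i, 0).
    elim/big_rec2: _ => // i y1 y2 _ ->.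
    by congr pair; rewrite /= scaler0 addr0.
  have E2 (I : finType) (k : I -> R) (u : I -> W) :
      \sum_i k i *: (0 : V, u i) = (0, \sum_i k i *: u i).
    elim/big_rec2: _ => // i y1 y2 _ ->.
    by congr pair; rewrite /= scaler0 addr0.
  rewrite E1 E2 -!frameE [LHS]surjective_pairing.
  by congr pair; rewrite /= ?addr0 ?add0r.
Defined.

End PairDerivative.

Lemma row_sum_vertical (R : realType) (V : normedModType R) (n : nat)
    (x : 'rV[R]_n) :
  (0, x) = \sum_i x ord0 i *: (0 : V, delta_mx ord0 i : 'rV[R]_n).
Proof.
rewrite {1}(row_sum_delta x); elim/big_rec2: _ => // i y1 y2 _ <-.
by congr pair; rewrite /= scaler0 addr0.
Qed.

Definition row_frame (R : realType) (n : nat) : frame 'rV[R]_n.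
Proof.
have cl (i : 'I_n) : linear (fun u : 'rV[R]_n => u ord0 i).
  by move=> k x y; rewrite !mxE.
pose cL i : {linear 'rV[R]_n -> R} :=
  HB.pack (fun u : 'rV[R]_n => u ord0 i) (GRing.isLinear.Build _ _ _ _ _ (cl i)).
apply: (@Frame _ _ n (fun i => delta_mx ord0 i) cL) => [i|v].
  exact: coord_continuous.
exact: row_sum_delta.
Defined.

#[local] Opaque derive.

Section SchwarzVector.
Context {R : realType} {V W : normedModType R} (F : frame W).

Lemma frame_coord_inj (w w' : W) :
  (forall i, frame_coord (f := F) i w = frame_coord i w') -> w = w'.
Proof.
move=> ww'; rewrite (frameE F w) (frameE F w').
by apply: eq_bigr => i _; rewrite ww'.
Qed.

Lemma smooth_derive_comm_vector (U : set V) (f : V -> W) x v w : open U ->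
  smooth_on U f -> U x -> 'D_v ('D_w f) x = 'D_w ('D_v f) x.
Proof.
move=> oU sf Ux; apply: frame_coord_inj => i.
have cc := frame_coord_continuous (f := F) (i := i).
have cD a b : frame_coord (f := F) i ('D_a ('D_b f) x)
    = 'D_a ('D_b (frame_coord (f := F) i \o f)) x.
  have dDf := smooth_on_diff (smooth_on_derive b sf) Ux.
  apply: (etrans (esym (derive_frame_coord i a dDf))).
  apply: near_eq_derive; apply: filterS (open_nbhs_nbhs (conj oU Ux)) => y Uy.
  exact: (esym (derive_frame_coord i b (smooth_on_diff sf Uy))).
apply: (etrans (cD v w)); apply: (etrans _ (esym (cD w v))).
exact: smooth_derive_comm oU (smooth_on_linear oU cc sf) Ux.
Qed.

End SchwarzVector.

Section SecondDerivative.
Context {R : realType} {E : normedModType R} (U : set E) (f : E -> R).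
Hypotheses (oU : open U) (sf : smooth_on U f).
Implicit Types (u v w z : E).

Lemma smooth_deriveDr v w z : U z -> 'D_(v + w) f z = 'D_v f z + 'D_w f z.
Proof.
by move=> /(smooth_on_diff sf) df; rewrite !deriveE// linearD.
Qed.

Lemma smooth_deriveZr (k : R) v z : U z -> 'D_(k *: v) f z = k *: 'D_v f z.
Proof.
by move=> /(smooth_on_diff sf) df; rewrite !deriveE// linearZ.
Qed.

Lemma derive3_rev u v w z : U z ->
  'D_u ('D_v ('D_w f)) z = 'D_w ('D_v ('D_u f)) z.
Proof.
move=> Uz.
have H1 := smooth_on_derive w sf.
have H2 := smooth_derive_comm u v oU H1 Uz.
apply: (etrans H2).
have near_comm a b : \forall y \near z, 'D_a ('D_b f) y = 'D_b ('D_a f) y.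
  apply: filterS (open_nbhs_nbhs (conj oU Uz)) => y Uy.
  exact: smooth_derive_comm oU sf Uy.
have H3 := near_eq_derive v (near_comm u w).
apply: (etrans H3).
have H4 := smooth_derive_comm v w oU (smooth_on_derive u sf) Uz.
exact: H4.
Qed.

End SecondDerivative.

(** * A regular Lagrangian in a natural chart *)

Section ChartLagrangian.
Context {R : realType} {V : normedModType R} (F : frame V).
Local Notation E := (V * V)%type.
Variables (O : set E) (l : E -> R).
Hypotheses (oO : open O) (sl : smooth_on O l).

Fact d2_key : unit. Proof. by []. Qed.

(** The second derivative of [l] at [z], a symmetric bilinear form. On vertical
    vectors it is the metric: [d2 z (0, x) (0, y)] is [g(x, y)]. *)
Definition d2 : E -> E -> E -> R :=
  locked_with d2_key (fun z v w => 'D_v ('D_w l) z).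

Lemma d2E z v w : d2 z v w = 'D_v ('D_w l) z.
Proof. by rewrite /d2 unlock. Qed.

Lemma d2C z v w : O z -> d2 z v w = d2 z w v.
Proof. by move=> Oz; rewrite !d2E; exact: (smooth_derive_comm v w oO sl Oz). Qed.

Lemma d2Dl z v v' w : O z -> d2 z (v + v') w = d2 z v w + d2 z v' w.
Proof.
by move=> Oz; rewrite !d2E; exact: (smooth_deriveDr (smooth_on_derive w sl)).
Qed.

Lemma d2Zl z k v w : O z -> d2 z (k *: v) w = k * d2 z v w.
Proof.
by move=> Oz; rewrite !d2E; exact: (smooth_deriveZr (smooth_on_derive w sl)).
Qed.

Lemma d2Nl z v w : O z -> d2 z (- v) w = - d2 z v w.
Proof. by move=> Oz; rewrite -scaleN1r d2Zl// mulN1r. Qed.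

Lemma d2Dr z v w w' : O z -> d2 z v (w + w') = d2 z v w + d2 z v w'.
Proof.
by move=> Oz; rewrite (d2C v (w + w') Oz) (d2Dl w w' v Oz) !(d2C v).
Qed.

Lemma d2Nr z v w : O z -> d2 z v (- w) = - d2 z v w.
Proof. by move=> Oz; rewrite (d2C v (- w) Oz) (d2Nl w v Oz) (d2C w v Oz). Qed.

Lemma d2_0l z w : d2 z 0 w = 0.
Proof. by rewrite d2E derive0. Qed.

Lemma d2_0r z v : O z -> d2 z v 0 = 0.
Proof. by move=> Oz; rewrite d2C// d2_0l. Qed.

Definition nondegenerate_at z :=
  forall x, (forall y, d2 z (0, x) (0, y) = 0) -> x = 0.

(** The symplectic form [d theta_L]: as [theta_L(eta) = 'D_(0, eta.1) l], only the
    second derivative of [l] enters. *)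
Definition omega z (xi eta : E) : R := d2 z xi (0, eta.1) - d2 z eta (0, xi.1).

Lemma omegaBl z xi xi' eta : O z ->
  omega z (xi - xi') eta = omega z xi eta - omega z xi' eta.
Proof.
move=> Oz; rewrite /omega d2Dl// d2Nl//=.
rewrite (_ : (0, xi.1 - xi'.1) = (0, xi.1) - (0, xi'.1)).
  rewrite d2Dr// d2Nr// !opprB [LHS]addrACA [RHS]addrACA; congr (_ + _).
  exact: addrC.
by congr pair; rewrite /= subr0.
Qed.

(** Vertical [eta] detect the first component of [xi - xi'], and then the other
    [eta] detect the second one. *)
Lemma omega_nondegenerate z xi xi' : O z -> nondegenerate_at z ->
  (forall eta, omega z xi eta = omega z xi' eta) -> xi = xi'.
Proof.
move=> Oz nd E; apply/eqP; rewrite -subr_eq0; apply/eqP.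
have {}E eta : omega z (xi - xi') eta = 0 by rewrite omegaBl// E subrr.
move: (xi - xi') E => {xi xi'} [x1 x2] E.
have x10 : x1 = 0.
  apply: nd => e; have := E (0, e); rewrite /omega /= d2_0r// sub0r d2C//.
  by move/eqP; rewrite oppr_eq0 => /eqP.
have x20 : x2 = 0.
  apply: nd => e; have := E (e, 0).
  by rewrite /omega /= x10 d2_0r// subr0.
by rewrite x10 x20.
Qed.

Lemma derive_along_vertical (y : E -> V) z : O z -> differentiable y z ->
  differentiable (fun z => 'D_(0, y z) l z) z /\
  forall v, 'D_v (fun z => 'D_(0, y z) l z) z =
    d2 z v (0, y z) + 'D_(0, 'D_v y z) l z.
Proof.
move=> Oz dy.
have dw : differentiable (fun z => (0 : V, y z)) z by exact: differentiable_pair.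
have [d D] := derive_along (pair_frame F F) oO sl Oz dw.
split=> // v; rewrite (D v) d2E (derive_pair v (differentiable_cst 0 z) dy).
have -> // : 'D_v (fun _ : E => 0 : V) z = 0 by exact: derive_cst.
Qed.

Section EulerLagrange.
Variables (gamma f : E -> V).
Hypotheses (sf : smooth_on O f).
Hypothesis nd : forall z, O z -> nondegenerate_at z.
Hypothesis EL : forall z, O z -> forall eta, omega z (gamma z, f z) eta =
  - 'D_eta (fun z => 'D_(0, z.2) l z - l z) z.

Lemma derive_energy z eta : O z ->
  'D_eta (fun z => 'D_(0, z.2) l z - l z) z
  = d2 z eta (0, z.2) - 'D_(eta.1, 0) l z.
Proof.
move=> Oz; have [d2z E2] := snd_is_diff z.
have [d D] := derive_along_vertical Oz d2z.
rewrite deriveB; [|exact: diff_derivable|]; last first.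
  by apply: diff_derivable; exact: smooth_on_diff sl Oz.
rewrite D (deriveE _ d2z) E2.
rewrite [eta in X in _ - X](_ : _ = (0, eta.2) + (eta.1, 0)); last first.
  by rewrite [LHS]surjective_pairing; congr pair; rewrite /= ?addr0 ?add0r.
by rewrite (smooth_deriveDr sl)//; ring.
Qed.

(** The vertical components of the Euler-Lagrange condition say that
    [g(gamma - u, -)] vanishes, where [u] is the velocity [z.2]. *)
Lemma second_order z : O z -> gamma z = z.2.
Proof.
move=> Oz; apply/eqP; rewrite -subr_eq0; apply/eqP; apply: (nd Oz) => e.
have := EL Oz (0, e); rewrite derive_energy// /omega /= d2_0r//.
have -> : 'D_(0, 0) l z = 0 by exact: derive0.
rewrite subr0 sub0r => /oppr_inj.
rewrite d2C// [in RHS]d2C// => E.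
rewrite (_ : (0, gamma z - z.2) = (0, gamma z) - (0, z.2)).
  by rewrite d2Dl// d2Nl// E subrr.
by congr pair; rewrite /= subr0.
Qed.

Lemma euler_lagrange_equation z e : O z ->
  d2 z (z.2, f z) (0, e) = 'D_(e, 0) l z.
Proof.
move=> Oz; have := EL Oz (e, 0); rewrite derive_energy// /omega /= second_order//.
by move/eqP; rewrite opprB subr_eq subrK => /eqP.
Qed.

(** The horizontal lift [x^k (d/dq^k - Gamma^i_k d/du^i)]; since
    [Gamma^i_k = - 1/2 df^i/du^k], its vertical part is half the derivative of
    [f] in the direction [(0, x)]. *)
Definition horizontal z (x : V) : E := (x, 2^-1 *: 'D_(0, x) f z).

(** Horizontal subspaces are Lagrangian for [d theta_L]. Deriving the
    Euler-Lagrange equation for [x] in the vertical direction [y], and exchanging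
    [x] and [y], gives two identities. Their difference contains no third
    derivative of [l], by Schwarz's theorem, and what remains is twice the
    claim. *)
Lemma horizontal_lagrangian z x y : O z ->
  d2 z (horizontal z x) (0, y) = d2 z (horizontal z y) (0, x).
Proof.
move=> Oz.
have dw : differentiable (fun z : E => (z.2, f z)) z.
  apply: differentiable_pair; first by have [] := snd_is_diff z.
  exact: smooth_on_diff sf Oz.
(* C a e collects the third derivatives of l. *)
have [C Csym D] : exists2 C : V -> V -> R, forall a e, C a e = C e a &
    forall a e, C a e + d2 z (a, 'D_(0, a) f z) (0, e) = d2 z (0, a) (e, 0).
  exists (fun a e => 'D_(0, a) ('D_(z.2, f z) ('D_(0, e) l)) z) => a e.
    exact: (derive3_rev oO sl _ _ _ Oz).
  have [_] := derive_along (pair_frame F F) oO (smooth_on_derive (0, e) sl) Oz dw.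
  move=> /(_ (0, a)); rewrite derive_pair; [| |]; last 2 first.
  - by have [] := snd_is_diff z.
  - exact: smooth_on_diff sf Oz.
  have [ds Es] := snd_is_diff z.
  rewrite (deriveE _ ds) Es /= => K; rewrite !d2E -K.
  apply: near_eq_derive; apply: filterS (open_nbhs_nbhs (conj oO Oz)) => y' Oy.
  by rewrite -d2E; exact: euler_lagrange_equation.
have h2 (a : V) : (a, 'D_(0, a) f z) = 2%:R *: horizontal z a - (a, 0).
  congr pair; rewrite /= ?scalerA ?divff ?pnatr_eq0// ?scale1r ?subr0//.
  by rewrite scaler_nat mulr2n addrK.
have := D x y; have := D y x; rewrite !h2 !d2Dl// !d2Nl// !d2Zl//.
rewrite (Csym x y) (d2C (0, x) (y, 0) Oz) (d2C (0, y) (x, 0) Oz).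
lra.
Qed.

End EulerLagrange.

(** * The recursion tensor in a natural chart *)

Section Recursion.
Variable j : V -> V -> V.
Variable z : E.
Hypothesis Oz : O z.
Hypothesis dj : forall y, differentiable (j^~ y) z.1.
Hypothesis Oj : forall y, O y -> j y.1 0 = 0.

(** The function [(J theta_L)(Y)] for the field [Y] along [tau] with constant
    components [y], where [j q] is the matrix of [J] at the base point [q]. *)
Definition Jtheta_chart (y : V) (z : E) : R := 'D_(0, j z.1 y) l z.

Lemma derive_Jtheta_chart y :
  differentiable (Jtheta_chart y) z /\
  forall v, 'D_v (Jtheta_chart y) z =
    d2 z v (0, j z.1 y) + 'D_(0, 'D_(v.1) (j^~ y) z.1) l z.
Proof.
have df := fst_is_diff z.
have dy : differentiable (j^~ y \o fst) z.
  by apply: differentiable_comp => //; case: df.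
have [d D] := derive_along_vertical Oz dy; split.
  exact: d.
move=> v; exact: (D v).
Qed.

(** [J] only depends on the base point, so it is constant along the fibres. *)
Lemma derive_Jtheta_chart_vertical y e :
  'D_(0, e) (Jtheta_chart y) z = d2 z (0, e) (0, j z.1 y).
Proof.
have [_ D] := derive_Jtheta_chart y; apply: (etrans (D (0, e))) => /=.
have -> : 'D_0 (j^~ y) z.1 = 0 by exact: derive0.
have -> : 'D_(0, 0) l z = 0 by exact: derive0.
by rewrite addr0.
Qed.

Lemma derive_Jtheta_chart0 v : 'D_v (Jtheta_chart 0) z = 0.
Proof.
rewrite (@near_eq_derive _ _ _ (Jtheta_chart 0) (cst 0)) ?derive_cst//.
apply: filterS (open_nbhs_nbhs (conj oO Oz)) => y Oy.
by rewrite /Jtheta_chart Oj//; exact: derive0.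
Qed.

(** Here [t] is the matrix of [T] at [z], the right-hand side of [tE] being
    [d d_(J^c S) L]; [jbar] and [u] are the matrices of the transpose of [J] and
    of [U], and [hor] is the horizontal lift. *)
Section Evaluation.
Variables (t : E -> E) (jbar u : V -> V) (hor : V -> E).
Hypothesis nd : nondegenerate_at z.
Hypothesis horE : forall x, (hor x).1 = x.
Hypothesis horL : forall x y,
  d2 z (hor x) (0, y) = d2 z (hor y) (0, x).
Hypothesis tE : forall xi eta, omega z (t xi) eta =
  'D_xi (Jtheta_chart eta.1) z - 'D_eta (Jtheta_chart xi.1) z.
Hypothesis jbarE : forall x y,
  d2 z (0, j z.1 x) (0, y) = d2 z (0, x) (0, jbar y).
Hypothesis uE : forall x y, d2 z (0, u x) (0, y) =
  'D_(hor x) (Jtheta_chart y) z - 'D_(hor y) (Jtheta_chart x) z.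

(** For vertical [xi] only the term [g(x, J e1)] of the right-hand side of [tE]
    survives, and it is [g(jbar x, e1)]. *)
Lemma recursion_vertical x : t (0, x) = (0, jbar x).
Proof.
apply: (omega_nondegenerate Oz nd) => -[e1 e2]; rewrite tE /=.
rewrite derive_Jtheta_chart0 derive_Jtheta_chart_vertical /omega /=.
by rewrite (d2_0r _ Oz) !subr0 (d2C _ _ Oz) jbarE (d2C _ _ Oz).
Qed.

(** Both sides are paired with [hor y + (0, e)]. The component [hor y] gives
    [d^H (J theta_L) (x, y)] on the left and [g(u x, y)] on the right, because
    horizontal vectors are [omega]-orthogonal to each other; the component
    [(0, e)] gives [- g(e, J x)] on both sides. *)
Lemma recursion_horizontal x : t (hor x) = hor (j z.1 x) + (0, u x).
Proof.
apply: (omega_nondegenerate Oz nd) => eta; rewrite tE horE.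
have -> : eta = hor eta.1 + (0, eta.2 - (hor eta.1).2).
  rewrite [LHS]surjective_pairing; congr pair; rewrite /= ?horE ?addr0//.
  by rewrite addrC subrK.
move: (eta.1) (eta.2 - _) => y e.
have [d _] := derive_Jtheta_chart x.
have dA : 'D_(hor y + (0, e)) (Jtheta_chart x) z =
    'D_(hor y) (Jtheta_chart x) z + 'D_(0, e) (Jtheta_chart x) z.
  by rewrite !deriveE// linearD.
rewrite dA /omega /= !horE !addr0 !(d2Dl _ _ _ Oz) derive_Jtheta_chart_vertical.
rewrite (horL (j z.1 x)) uE.
set A := 'D_(hor x) _ z; set B := 'D_(hor y) _ z.
by move: A B (d2 _ _ _) (d2 _ _ _) => A B C D; ring.
Qed.

End Evaluation.
End Recursion.

End ChartLagrangian.

(** * Fields with constant components in a chart *)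

Section AtlasFields.
Context {R : realType} {V : normedModType R} {M : Type} (A : atlas V M).

Lemma tcomp_inj a p (u w : tangent A p) :
  dom A a p -> tcomp u a = tcomp w a -> u = w.
Proof. by move=> ap uw; rewrite -(tvecK u ap) uw tvecK. Qed.

Lemma chart_dom a p : dom A a p -> (chart A a @` dom A a) (chart A a p).
Proof. by move=> ap; exists p. Qed.

Lemma dom_aopen a : aopen A (dom A a).
Proof. by move=> b; rewrite setIC; exact: overlap_open. Qed.

(** The components in another chart [b] are the derivative of the transition map
    from [a] to [b], composed with the transition map back. Through these fields,
    identities between smooth vector fields become identities between tangent
    vectors. *)
Lemma smooth_coordinate_field (F : frame V) a w :
  smooth_vf (dom A a) (fun p => tvec a p w).
Proof.
move=> b.
have oba : open (chart A b @` (dom A a `&` dom A b)).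
  by rewrite setIC; exact: overlap_open.
apply: (@smooth_on_ext _ _ _ _
  ('D_w (chart A b \o param A a) \o (chart A a \o param A b))) => //.
- move=> _ [p [ap bp] <-]; rewrite /vf_rep /= chartK//= /tvec_comps.
  case: asboolP => [_|[]//].
  exact: deriveE (transition_differentiable ap bp).
- apply: (smooth_on_comp (U' := chart A a @` (dom A a `&` dom A b)) F) => //.
  + exact: overlap_open.
  + by move=> _ [p [ap bp] <-]; exists p; rewrite //= chartK.
  + by rewrite setIC; exact: transition_smooth.
  + exact: smooth_on_derive (transition_smooth A a b).
Qed.

End AtlasFields.

(** * From the tangent bundle to natural charts *)

Section TangentBundleChart.
Context {R : realType} {n : nat} {M : Type} (A : atlas 'rV[R]_n M).
Local Notation V := 'rV[R]_n.
Local Notation E := (V * V)%type.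
Local Notation TM := (tbundle A).
Local Notation TA := (tb_atlas A).
Local Notation FV := (row_frame R n).

Definition coordinate_along (a : chart_id A) (w : V) : vfield_along A :=
  fun v => tvec a (tau v) w.

Lemma smooth_coordinate_along a w :
  smooth_vf_along (dom TA a) (coordinate_along a w).
Proof.
move=> b; have -> : chart TA b @` (dom TA a `&` dom TA b)
    = fst @^-1` (chart A b @` (dom A a `&` dom A b)).
  by rewrite setIC [dom A a `&` _]setIC; exact: tb_overlap.
have oba : open (chart A b @` (dom A a `&` dom A b)).
  by rewrite setIC; exact: overlap_open.
exact: (smooth_on_fst oba (@smooth_coordinate_field _ _ _ A FV a w b)).
Qed.

Variable a : chart_id A.
Local Notation O := (chart TA a @` dom TA a).

Let oO : open O. Proof. exact: dom_open. Qed.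

Lemma tau_chart_dom z : O z -> (chart A a @` dom A a) z.1.
Proof. by move=> [v av <-]; exists (tau v). Qed.

Lemma tau_param_dom z : O z -> dom A a (param A a z.1).
Proof. by move=> /tau_chart_dom; exact: param_dom. Qed.

Section Lagrangian.
Variable L : TM -> R.
Hypothesis sL : smooth_fun TA L.
Let l : E -> R := L \o param TA a.
Let sl : smooth_on O l. Proof. exact: sL. Qed.

Lemma theta_rep w z : O z -> form_rep (A := TA) a (theta a L) w z = 'D_(0, w.1) l z.
Proof.
move=> Oz; have az := param_dom Oz.
rewrite /form_rep /theta /d_op /dfun /vert_endo.
by rewrite (tcomp_tvec (A := TA) _ az) (tcomp_tvec (A := TA) _ az) paramK.
Qed.

Lemma dtheta_chart v (xi eta : tangent TA v) : dom TA a v ->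
  dform (A := TA) a (theta a L) xi eta
  = omega l (chart TA a v) (tcomp xi a) (tcomp eta a).
Proof.
move=> av; have Oz := chart_dom av; rewrite /omega !d2E.
have D u w : 'D_u (form_rep (A := TA) a (theta a L) w) (chart TA a v)
    = 'D_u ('D_(0, w.1) l) (chart TA a v).
  apply: near_eq_derive; apply: filterS (open_nbhs_nbhs (conj oO Oz)) => z.
  exact: theta_rep.
exact: (congr2 (fun x y => x - y) (D _ _) (D _ _)).
Qed.

Lemma nondegenerate_regular z : regular L -> O z -> nondegenerate_at l z.
Proof.
move=> reg Oz x nx.
have := reg a _ (param_dom Oz); set H := hessian _ _ _ => uH.
suff xH : x *m H = 0 by rewrite -(mulmxK uH x) xH mul0mx.
apply/rowP => j; rewrite !mxE -[RHS](nx (delta_mx ord0 j)) d2E.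
have dd := smooth_on_diff (smooth_on_derive (0, delta_mx ord0 j) sl) Oz.
have dv (y : V) : 'D_(0, y) ('D_(0, delta_mx ord0 j) l) z
    = 'd ('D_(0, delta_mx ord0 j) l) z (0, y) by exact: deriveE.
rewrite dv (row_sum_vertical V x) linear_sum; apply: eq_bigr => i _.
by rewrite linearZ /= -dv /H mxE (paramK Oz).
Qed.

End Lagrangian.
End TangentBundleChart.

Section RecursionInChart.
Context {R : realType} {n : nat} {M : Type} (A : atlas 'rV[R]_n M).
Local Notation V := 'rV[R]_n.
Local Notation E := (V * V)%type.
Local Notation TM := (tbundle A).
Local Notation TA := (tb_atlas A).
Local Notation FV := (row_frame R n).
Variable a : chart_id A.
Local Notation O := (chart TA a @` dom TA a).

Let oO : open O. Proof. exact: dom_open. Qed.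

Variables (L : TM -> R) (Gamma : vfield TA).
Hypothesis sL : smooth_fun TA L.
Hypothesis reg : regular L.
Hypothesis sGamma : smooth_vf [set: TM] Gamma.
Hypothesis EL : is_euler_lagrange_field L Gamma.

Let l : E -> R := L \o param TA a.
Let sl : smooth_on O l. Proof. exact: sL. Qed.
Let gamma (z : E) : V := (vf_rep (A := TA) a Gamma z).1.
Let f (z : E) : V := (vf_rep (A := TA) a Gamma z).2.

Let sf : smooth_on O f.
Proof.
have sG : smooth_on O (vf_rep (A := TA) a Gamma).
  by have H : smooth_vf [set: TM] Gamma := sGamma; move: (H a); rewrite setTI.
exact: (smooth_on_snd oO sG).
Qed.

Lemma energy_chart z : O z ->
  (energy a L \o param TA a) z = 'D_(0, z.2) l z - l z.
Proof.
move=> Oz; have az := param_dom Oz; have qz := tau_param_dom Oz.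
have uz : tcomp (projT2 (param TA a z)) a = z.2 := tcomp_tvec z.2 qz.
rewrite -[LHS]/(energy a L (param TA a z)) /energy /dfun /liouville.
by rewrite (tcomp_tvec (A := TA) _ az) (paramK Oz) uz.
Qed.

Lemma euler_lagrange_chart z : O z -> forall eta,
  omega l z (gamma z, f z) eta = - 'D_eta (fun z => 'D_(0, z.2) l z - l z) z.
Proof.
move=> Oz eta; have az := param_dom Oz.
have := EL az (tvec (A := TA) a _ eta).
rewrite (@dtheta_chart _ _ _ A a L _ _ _ az) (paramK Oz) (tcomp_tvec (A := TA) _ az).
rewrite /gamma /f -surjective_pairing => ->; congr (- _).
rewrite /dfun (tcomp_tvec (A := TA) _ az) (paramK Oz).
apply: near_eq_derive; apply: filterS (open_nbhs_nbhs (conj oO Oz)) => y.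
exact: energy_chart.
Qed.

(** The connection matrix [- 1/2 df^i/du^j] applied to [x] is a derivative of [f],
    so that no coordinates are needed to derive it further. *)
Lemma mulmx_conn v x : dom TA a v ->
  x *m conn Gamma a v = - (2^-1 *: 'D_(0, x) f (chart TA a v)).
Proof.
move=> av; have Oz := chart_dom av.
have df := smooth_on_diff sf Oz; apply/rowP => i.
have Dx : 'D_(0, x) f (chart TA a v)
    = \sum_j x ord0 j *: 'D_(0, delta_mx ord0 j) f (chart TA a v).
  apply: (etrans (deriveE _ df)); rewrite (row_sum_vertical V x) linear_sum.
  by apply: eq_bigr => j _; rewrite linearZ; congr (_ *: _); apply/esym/deriveE.
have connE j : conn Gamma a v j i
    = - 2^-1 * ('D_(0, delta_mx ord0 j) f (chart TA a v)) ord0 i.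
  rewrite mxE; congr (_ * _).
  by rewrite (derive_mx (diff_derivable (v := (0, delta_mx ord0 j)) df)) mxE.
rewrite Dx !mxE summxE mulr_sumr -sumrN; apply: eq_bigr => j _.
by rewrite connE mxE mulNr mulrN mulrCA.
Qed.

Lemma hlift_chart v (w : tangent A (tau v)) : dom TA a v ->
  tcomp (hlift Gamma a w) a = horizontal f (chart TA a v) (tcomp w a).
Proof.
by move=> av; rewrite /hlift (tcomp_tvec (A := TA) _ av) mulmx_conn// opprK.
Qed.

Lemma vlift_chart v (w : tangent A (tau v)) : dom TA a v ->
  tcomp (vlift a w) a = (0, tcomp w a).
Proof. by move=> av; rewrite /vlift (tcomp_tvec (A := TA) _ av). Qed.

Definition rep_along (X : vfield_along A) (z : E) : V := tcomp (X (param TA a z)) a.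

Lemma rep_along_chart X v : dom TA a v -> rep_along X (chart TA a v) = tcomp (X v) a.
Proof. by move=> av; rewrite /rep_along chartK. Qed.

(** The bracket that defines the covariant derivatives: [D^V_Y X] is minus its
    first component, and [D^H_X Y] is its vertical part. *)
Lemma bracketHV_chart X Y v : dom TA a v ->
  smooth_on O (rep_along X) -> smooth_on O (rep_along Y) ->
  let z := chart TA a v in
  tcomp (bracket (A := TA) a (vfield_hlift Gamma a X) (vfield_vlift a Y) v) a =
  (- 'D_(0, rep_along Y z) (rep_along X) z,
   'D_(horizontal f z (rep_along X z)) (rep_along Y) z
   - 'D_(0, rep_along Y z) (fun z => 2^-1 *: 'D_(0, rep_along X z) f z) z).
Proof.
move=> av sX sY z; have Oz : O z := chart_dom av.
have dX := smooth_on_diff sX Oz; have dY := smooth_on_diff sY Oz.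
have dw : differentiable (fun z => (0 : V, rep_along X z)) z.
  by apply: differentiable_pair => //; exact: differentiable_cst.
have [dh _] := derive_along (pair_frame FV FV) oO sf Oz dw.
have dh2 : differentiable (fun z => 2^-1 *: 'D_(0, rep_along X z) f z) z.
  exact: (differentiableZ 2^-1 dh).
have HX y : O y -> vf_rep (A := TA) a (vfield_hlift Gamma a X) y
    = (rep_along X y, 2^-1 *: 'D_(0, rep_along X y) f y).
  move=> Oy; rewrite /vf_rep /vfield_hlift (hlift_chart _ (param_dom Oy)).
  by rewrite (paramK Oy).
have VY y : O y -> vf_rep (A := TA) a (vfield_vlift a Y) y = (0, rep_along Y y).
  by move=> Oy; rewrite /vf_rep /vfield_vlift (vlift_chart _ (param_dom Oy)).
rewrite /bracket (tcomp_tvec (A := TA) _ av) -/z (HX z Oz) (VY z Oz).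
have nearO : nbhs z O by exact: open_nbhs_nbhs (conj oO Oz).
have D1 u : 'D_u (vf_rep (A := TA) a (vfield_vlift a Y)) z = (0, 'D_u (rep_along Y) z).
  apply: (etrans (near_eq_derive u (filterS VY nearO))).
  apply: (etrans (derive_pair u (differentiable_cst 0 z) dY)).
  by congr pair; exact: derive_cst.
have D2 u : 'D_u (vf_rep (A := TA) a (vfield_hlift Gamma a X)) z
   = ('D_u (rep_along X) z, 'D_u (fun z => 2^-1 *: 'D_(0, rep_along X z) f z) z).
  apply: (etrans (near_eq_derive u (filterS HX nearO))).
  exact: (derive_pair u dX dh2).
apply: (etrans (congr2 (fun x y => x - y) (D1 _) (D2 _))).
by congr pair; rewrite sub0r.
Qed.

Lemma theta_along_chart v (w : tangent A (tau v)) : dom TA a v ->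
  theta_along a L w = 'D_(0, tcomp w a) l (chart TA a v).
Proof. by move=> av; rewrite /theta_along /dfun vlift_chart. Qed.

(** The term [theta_L(D^V_X Y)] of [(D^V_X theta_L)(Y)] cancels the derivative of
    the components of [Y]. *)
Lemma metric_chart X Y v : dom TA a v ->
  smooth_on O (rep_along X) -> smooth_on O (rep_along Y) ->
  metric Gamma a L X Y v =
    d2 l (chart TA a v) (0, tcomp (X v) a) (0, tcomp (Y v) a).
Proof.
move=> av sX sY; have Oz := chart_dom av; have dY := smooth_on_diff sY Oz.
have nearO : nbhs (chart TA a v) O by exact: open_nbhs_nbhs (conj oO Oz).
have covVE : tcomp (covV Gamma a X Y v) a
    = 'D_(0, rep_along X (chart TA a v)) (rep_along Y) (chart TA a v).
  rewrite /covV /hpart -[LHS]/(- tcomp _ a) (tcomp_tvec (A := A) _ av).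
  by rewrite bracketHV_chart// opprK.
have [_ D] := derive_along_vertical FV oO sl Oz dY.
rewrite /metric /covV_form (theta_along_chart _ av) covVE /dfun.
rewrite (vlift_chart _ av) -(rep_along_chart X av) -(rep_along_chart Y av).
have E1 : 'D_(0, rep_along X (chart TA a v))
    ((fun v => theta_along a L (Y v)) \o param TA a) (chart TA a v) =
   'D_(0, rep_along X (chart TA a v)) (fun z => 'D_(0, rep_along Y z) l z)
    (chart TA a v).
  apply: near_eq_derive; apply: filterS nearO => z Oz'.
  by apply: (etrans (theta_along_chart _ (param_dom Oz'))); rewrite (paramK Oz').
apply: (etrans (congr1 (fun x => x - _) (etrans E1 (D _)))).
exact: addrK.
Qed.

Variables (J : tensor11 A) (Jc : tensor11 TA).
Hypothesis sJ : smooth_tensor11 J.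
Hypothesis lJ : is_complete_lift J Jc.

Definition tensor_rep (q w : V) : V :=
  tcomp (J (param A a q) (tvec a (param A a q) w)) a.

Lemma tensor_repE p (w : tangent A p) : dom A a p ->
  tcomp (J p w) a = tensor_rep (chart A a p) (tcomp w a).
Proof. by move=> ap; rewrite /tensor_rep chartK// tvecK. Qed.

Lemma tvec0 p : dom A a p -> tvec a p 0 = 0 :> tangent A p.
Proof. by move=> ap; apply: (tcomp_inj ap); rewrite tcomp_tvec. Qed.

Lemma tensor_rep0 z : O z -> tensor_rep z.1 0 = 0.
Proof.
by move=> Oz; rewrite /tensor_rep (tvec0 (tau_param_dom Oz)) linear0.
Qed.

Lemma differentiable_tensor_rep w z : O z ->
  differentiable (tensor_rep^~ w) z.1.
Proof.
have H : smooth_tensor11 J := sJ; move=> /tau_chart_dom.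
exact: (smooth_on_diff (H a w)).
Qed.

Lemma Jtheta_along_chart y v : dom TA a v ->
  Jtheta a J L (coordinate_along a y v)
  = Jtheta_chart l tensor_rep y (chart TA a v).
Proof.
move=> av; apply: (etrans (theta_along_chart _ av)).
have -> // : tcomp (J (tau v) (coordinate_along a y v)) a
    = tensor_rep (chart TA a v).1 y.
by rewrite (tensor_repE _ av) (tcomp_tvec (A := A) _ av).
Qed.

(** [J^c S] sends [w] to the vertical lift of [J] applied to the projection of
    [w]. *)
Lemma dJSL_rep w z : O z ->
  form_rep (A := TA) a (d_op (A := TA) a (fun v zeta => Jc v (vert_endo a zeta)) L) w z
  = Jtheta_chart l tensor_rep w.1 z.
Proof.
move=> Oz; have az := param_dom Oz; have qz := tau_param_dom Oz.
rewrite /form_rep /d_op /dfun /vert_endo (tcomp_tvec (A := TA) _ az).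
set v := param TA a z in az *.
have H : is_complete_lift J Jc := lJ.
have [_] := H _ _ (dom_aopen (A := A) a)
  (@smooth_coordinate_field _ _ _ A FV a w.1) a v qz qz.
rewrite [vlift a _]/vlift (tcomp_tvec (A := A) _ qz) => ->.
rewrite (vlift_chart _ az) tensor_repE// (tcomp_tvec (A := A) _ qz).
by rewrite -[chart A a (tau v)]/(chart TA a v).1 /v (paramK Oz).
Qed.

Lemma dJSL_chart v (xi eta : tangent TA v) : dom TA a v ->
  dform (A := TA) a
    (d_op (A := TA) a (fun v zeta => Jc v (vert_endo a zeta)) L) xi eta
  = 'D_(tcomp xi a) (Jtheta_chart l tensor_rep (tcomp eta a).1) (chart TA a v)
    - 'D_(tcomp eta a) (Jtheta_chart l tensor_rep (tcomp xi a).1) (chart TA a v).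
Proof.
move=> av; have Oz := chart_dom av.
have D u w : 'D_u (form_rep (A := TA) a
    (d_op (A := TA) a (fun v zeta => Jc v (vert_endo a zeta)) L) w) (chart TA a v)
    = 'D_u (Jtheta_chart l tensor_rep w.1) (chart TA a v).
  apply: near_eq_derive; apply: filterS (open_nbhs_nbhs (conj oO Oz)) => z.
  exact: dJSL_rep.
exact: (congr2 (fun x y => x - y) (D _ _) (D _ _)).
Qed.

Lemma rep_coordinate_along y z : O z -> rep_along (coordinate_along a y) z = y.
Proof.
by move=> Oz; exact: (tcomp_tvec (A := A) y (tau_param_dom Oz)).
Qed.

Lemma smooth_rep_coordinate_along y :
  smooth_on O (rep_along (coordinate_along a y)).
Proof.
apply: (smooth_on_ext (f := cst y) oO); last exact: smooth_on_cst.
by move=> z Oz; rewrite rep_coordinate_along.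
Qed.

Lemma covH_coordinate x y v : dom TA a v ->
  tcomp (covH Gamma a (coordinate_along a x) (coordinate_along a y) v) a
  = - 'D_(0, y) (fun z => 2^-1 *: 'D_(0, x) f z) (chart TA a v).
Proof.
move=> av; have Oz := chart_dom av.
have nearO : nbhs (chart TA a v) O by exact: open_nbhs_nbhs (conj oO Oz).
have D0 w u : 'D_u (rep_along (coordinate_along a w)) (chart TA a v) = 0.
  apply: (etrans (near_eq_derive u (g := cst w) _)); last exact: derive_cst.
  by apply: filterS nearO => z; exact: rep_coordinate_along.
set zeta := bracket (A := TA) a (vfield_hlift Gamma a (coordinate_along a x))
  (vfield_vlift a (coordinate_along a y)) v.
have zE : tcomp zeta a
    = (0, - 'D_(0, y) (fun z => 2^-1 *: 'D_(0, x) f z) (chart TA a v)).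
  have sx := smooth_rep_coordinate_along x; have sy := smooth_rep_coordinate_along y.
  apply: (etrans (bracketHV_chart av sx sy)).
  congr pair; first exact: (etrans (congr1 -%R (D0 _ _)) (oppr0 _)).
  apply: (etrans (congr1 (fun x => x - _) (D0 _ _))).
  apply: (etrans (sub0r _)); rewrite (rep_coordinate_along y Oz).
  apply: (congr1 -%R); apply: near_eq_derive; apply: filterS nearO => z Oz'.
  by rewrite (rep_coordinate_along x Oz').
rewrite /covH -/zeta /vpart (tcomp_tvec (A := A) _ av).
have -> : tcomp (zeta - hlift Gamma a (hpart a zeta)) a =
  tcomp zeta a - tcomp (hlift Gamma a (hpart a zeta)) a by [].
rewrite (hlift_chart _ av) /hpart (tcomp_tvec (A := A) _ av) zE /=.
have -> : 'D_(0, 0) f (chart TA a v) = 0 by exact: derive0.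
by rewrite scaler0 subr0.
Qed.

(** The horizontal connection is torsion free: its coefficients
    [- 1/2 d^2 f^i / du^j du^k] are symmetric, by Schwarz's theorem. *)
Lemma covH_coordinateC x y v : dom TA a v ->
  covH Gamma a (coordinate_along a x) (coordinate_along a y) v
  = covH Gamma a (coordinate_along a y) (coordinate_along a x) v.
Proof.
move=> av; have Oz := chart_dom av.
apply: (tcomp_inj (A := A) (a := a) av).
apply: (etrans (covH_coordinate x y av)).
apply: (etrans _ (esym (covH_coordinate y x av))).
have dD w u : 'D_u (fun z => 2^-1 *: 'D_w f z) (chart TA a v)
    = 2^-1 *: 'D_u ('D_w f) (chart TA a v).
  apply: deriveZ; apply: diff_derivable.
  exact: smooth_on_diff (smooth_on_derive w sf) Oz.
apply: (congr1 -%R); apply: (etrans (dD _ _)); apply: (etrans _ (esym (dD _ _))).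
apply: (congr1 ( *:%R 2^-1)).
exact: (smooth_derive_comm_vector FV _ _ oO sf Oz).
Qed.

(** By [covH_coordinateC] the covariant derivatives of the two coordinate fields
    contribute equal terms of opposite signs. *)
Lemma dH_chart x y v : dom TA a v ->
  dH Gamma a (Jtheta a J L) (coordinate_along a x) (coordinate_along a y) v
  = 'D_(horizontal f (chart TA a v) x) (Jtheta_chart l tensor_rep y) (chart TA a v)
  - 'D_(horizontal f (chart TA a v) y) (Jtheta_chart l tensor_rep x) (chart TA a v).
Proof.
move=> av; have Oz := chart_dom av.
have D u w : dfun (A := TA) a (fun v => Jtheta a J L (coordinate_along a w v))
    (hlift Gamma a (coordinate_along a u v))
  = 'D_(horizontal f (chart TA a v) u) (Jtheta_chart l tensor_rep w) (chart TA a v).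
  rewrite /dfun (hlift_chart _ av) /coordinate_along (tcomp_tvec (A := A) _ av).
  apply: near_eq_derive; apply: filterS (open_nbhs_nbhs (conj oO Oz)) => z Oz'.
  apply: (etrans (Jtheta_along_chart _ (param_dom Oz'))).
  by rewrite (paramK Oz').
rewrite /dH /covH_form (covH_coordinateC x y av) opprB addrA subrK.
exact: (congr2 (fun s t => s - t) (D _ _) (D _ _)).
Qed.

Lemma rep_act_coordinate (K : tensor11_along A) w :
  smooth_tensor11_along K ->
  smooth_on O (rep_along (act K (coordinate_along a w))).
Proof. by move=> sK; exact: (sK a w). Qed.

Lemma rep_act_along_coordinate w :
  smooth_on O (rep_along (act (along J) (coordinate_along a w))).
Proof.
have H : smooth_tensor11 J := sJ.
have Oq : O = fst @^-1` (chart A a @` dom A a).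
  by have := tb_overlap a a; rewrite !setIid.
by rewrite Oq; exact: (smooth_on_fst (dom_open (A := A) a) (H a w)).
Qed.

Let EL_nd z : O z -> nondegenerate_at l z.
Proof. by move=> Oz; exact: nondegenerate_regular. Qed.

(** From here on the hypotheses of the statement are applied to fields with
    constant components, which turns them into those of [recursion_vertical] and
    [recursion_horizontal]. *)
Section Conclusion.
Variables (T : tensor11 TA) (Jbar U : tensor11_along A).
Hypothesis TE : forall (W : set TM) (xi : vfield TA),
  aopen TA W -> smooth_vf W xi ->
  forall v, W v -> dom TA a v -> forall eta : tangent TA v,
  dform (A := TA) a (theta a L) (T v (xi v)) eta
  = dform (A := TA) a
      (d_op (A := TA) a (fun w zeta => Jc w (vert_endo a zeta)) L) (xi v) eta.
Hypothesis sJbar : smooth_tensor11_along Jbar.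
Hypothesis JbarE : forall (W : set TM) (X Y : vfield_along A),
  aopen TA W -> smooth_vf_along W X -> smooth_vf_along W Y ->
  forall v, W v -> dom TA a v ->
  metric Gamma a L (act (along J) X) Y v = metric Gamma a L X (act Jbar Y) v.
Hypothesis sU : smooth_tensor11_along U.
Hypothesis UE : forall (W : set TM) (X Y : vfield_along A),
  aopen TA W -> smooth_vf_along W X -> smooth_vf_along W Y ->
  forall v, W v -> dom TA a v ->
  metric Gamma a L (act U X) Y v = dH Gamma a (Jtheta a J L) X Y v.
Variable v : TM.
Hypothesis av : dom TA a v.
Let z := chart TA a v.
Let Oz : O z. Proof. exact: chart_dom. Qed.

Let t (xi : E) : E := tcomp (T v (tvec (A := TA) a v xi)) a.
Let jbar (w : V) : V := tcomp (Jbar v (tvec (A := A) a (tau v) w)) a.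
Let u (w : V) : V := tcomp (U v (tvec (A := A) a (tau v) w)) a.

Let coordinate_along_chart w : tcomp (coordinate_along a w v) a = w.
Proof. exact: (tcomp_tvec (A := A) w av). Qed.

Let tE xi eta : omega l z (t xi) eta =
  'D_xi (Jtheta_chart l tensor_rep eta.1) z
  - 'D_eta (Jtheta_chart l tensor_rep xi.1) z.
Proof.
have := TE (dom_aopen (A := TA) a)
  (@smooth_coordinate_field _ _ _ TA (pair_frame FV FV) a xi) av av
  (tvec (A := TA) a v eta).
rewrite (@dtheta_chart _ _ _ A a L _ _ _ av) (dJSL_chart _ _ av).
by rewrite (tcomp_tvec (A := TA) xi av) (tcomp_tvec (A := TA) eta av).
Qed.

Let jbarE x y : d2 l z (0, tensor_rep z.1 x) (0, y) = d2 l z (0, x) (0, jbar y).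
Proof.
have := JbarE (dom_aopen (A := TA) a) (smooth_coordinate_along (a := a) x)
  (smooth_coordinate_along (a := a) y) av av.
rewrite (metric_chart av (rep_act_along_coordinate x) (smooth_rep_coordinate_along y)).
rewrite (metric_chart av (smooth_rep_coordinate_along x) (rep_act_coordinate y sJbar)).
rewrite !coordinate_along_chart => E1; apply: (etrans _ E1).
have -> // : tensor_rep z.1 x = tcomp (act (along J) (coordinate_along a x) v) a.
by apply/esym; apply: (etrans (tensor_repE _ av)); rewrite coordinate_along_chart.
Qed.

Let uE x y : d2 l z (0, u x) (0, y) =
  'D_(horizontal f z x) (Jtheta_chart l tensor_rep y) z
  - 'D_(horizontal f z y) (Jtheta_chart l tensor_rep x) z.
Proof.
have := UE (dom_aopen (A := TA) a) (smooth_coordinate_along (a := a) x)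
  (smooth_coordinate_along (a := a) y) av av.
rewrite (metric_chart av (rep_act_coordinate x sU) (smooth_rep_coordinate_along y)).
by rewrite (dH_chart x y av) coordinate_along_chart.
Qed.

Let horL x y :
  d2 l z (horizontal f z x) (0, y) = d2 l z (horizontal f z y) (0, x).
Proof.
exact: (horizontal_lagrangian FV oO sl sf EL_nd euler_lagrange_chart x y Oz).
Qed.

Lemma recursion_vlift (w : tangent A (tau v)) :
  T v (vlift a w) = vlift a (Jbar v w).
Proof.
apply: (tcomp_inj (A := TA) av); rewrite (vlift_chart _ av).
apply: (etrans (recursion_vertical FV oO sl Oz
  (fun y => differentiable_tensor_rep y Oz) tensor_rep0 (EL_nd Oz) tE jbarE
  (tcomp w a))).
by congr (0, _); rewrite /jbar (tvecK (A := A) w av).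
Qed.

Lemma recursion_hlift (w : tangent A (tau v)) :
  T v (hlift Gamma a w) = hlift Gamma a (J (tau v) w) + vlift a (U v w).
Proof.
apply: (tcomp_inj (A := TA) av).
have addE (p q : tangent TA v) : tcomp (p + q) a = tcomp p a + tcomp q a by [].
rewrite addE.
rewrite (vlift_chart _ av) (hlift_chart _ av).
have E1 := recursion_horizontal FV oO sl Oz
  (fun y => differentiable_tensor_rep y Oz) (EL_nd Oz)
  (fun x : V => erefl : (horizontal f z x).1 = x) horL tE
  uE (tcomp w a).
have tw : t (horizontal f z (tcomp w a)) = tcomp (T v (hlift Gamma a w)) a.
  by rewrite /t -(hlift_chart w av) (tvecK (A := TA) _ av).
rewrite -tw; apply: (etrans E1).
by rewrite (tensor_repE _ av) /u (tvecK (A := A) w av).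
Qed.

End Conclusion.

End RecursionInChart.

Theorem proposition1 (R : realType) (n : nat) (Q : smoothManifold R n)
    (L : tbundle Q -> R) (J : tensor11 Q) (Jc : tensor11 (tb_atlas Q))
    (Gamma : vfield (tb_atlas Q)) (T : tensor11 (tb_atlas Q))
    (Jbar U : tensor11_along Q) :
  smooth_fun (tb_atlas Q) L ->
  regular L ->
  smooth_tensor11 J ->
  smooth_tensor11 Jc ->
  is_complete_lift J Jc ->
  smooth_vf [set: tbundle Q] Gamma ->
  is_euler_lagrange_field L Gamma ->
  smooth_tensor11 T ->
  (* i_(T xi) d d_S L = i_xi d d_(Jc S) L *)
  (forall (W : set (tbundle Q)) (xi : vfield (tb_atlas Q)),
    aopen (tb_atlas Q) W -> smooth_vf W xi ->
    forall (a : chart_id Q) (v : tbundle Q), W v -> dom (tb_atlas Q) a v ->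
    forall eta : tangent (tb_atlas Q) v,
      dform (A := tb_atlas Q) a
        (d_op (A := tb_atlas Q) a (vert_endo a) L) (T v (xi v)) eta
      = dform (A := tb_atlas Q) a
        (d_op (A := tb_atlas Q) a (fun w zeta => Jc w (vert_endo a zeta)) L)
        (xi v) eta) ->
  smooth_tensor11_along Jbar ->
  (* g(J X, Y) = g(X, Jbar Y) *)
  (forall (W : set (tbundle Q)) (X Y : vfield_along Q),
    aopen (tb_atlas Q) W -> smooth_vf_along W X -> smooth_vf_along W Y ->
    forall (a : chart_id Q) (v : tbundle Q), W v -> dom (tb_atlas Q) a v ->
      metric Gamma a L (act (along J) X) Y v
      = metric Gamma a L X (act Jbar Y) v) ->
  smooth_tensor11_along U ->
  (* g(U X, Y) = d^H (J theta_L) (X, Y) *)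
  (forall (W : set (tbundle Q)) (X Y : vfield_along Q),
    aopen (tb_atlas Q) W -> smooth_vf_along W X -> smooth_vf_along W Y ->
    forall (a : chart_id Q) (v : tbundle Q), W v -> dom (tb_atlas Q) a v ->
      metric Gamma a L (act U X) Y v = dH Gamma a (Jtheta a J L) X Y v) ->
  forall (W : set (tbundle Q)) (X : vfield_along Q),
    aopen (tb_atlas Q) W -> smooth_vf_along W X ->
    forall (a : chart_id Q) (v : tbundle Q), W v -> dom (tb_atlas Q) a v ->
      T v (vlift a (X v)) = vlift a (Jbar v (X v)) /\
      T v (hlift Gamma a (X v))
      = hlift Gamma a (J (tau v) (X v)) + vlift a (U v (X v)).
Proof.
move=> sL reg sJ _ lJ sGamma EL _ TE sJbar JbarE sU UE W X _ _ a v _ av.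
split.
- apply: (recursion_vlift sL reg sGamma sJ lJ (a := a)
    (fun W xi oW sxi v Wv => TE W xi oW sxi a v Wv) sJbar
    (fun W X Y oW sX sY v => JbarE W X Y oW sX sY a v) av).
- apply: (recursion_hlift sL reg sGamma EL sJ lJ (a := a)
    (fun W xi oW sxi v Wv => TE W xi oW sxi a v Wv) sU
    (fun W X Y oW sX sY v => UE W X Y oW sX sY a v) av).
Qed.
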